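(* Let $c>0$ and $\tilde w=\bar\varepsilon v_1$ be the constant and the function defined in the context, and let $g\in\mathcal C(\mathcal O)$ satisfy $g\ge -c$. Let $u,v$ be smooth functions on $\bar{\mathcal O}$ such that $u\ge\tilde w$, $v(x)>\tilde w(x)$ for all $x\in\bar{\mathcal O}$, and $$-\Delta u+\tfrac12|\nabla u|^2+ru\le g\quad\text{in }\mathcal O,$$ $$-\Delta v+\tfrac12|\nabla v|^2+rv\ge g\quad\text{in }\mathcal O,$$ $$\partial_\eta u=\partial_\eta v=0\quad\text{on }\partial\mathcal O.$$ Then $u\le v$.
   Context: Setting: $\mathcal O\subset\mathbb R^d$ is a bounded smooth connected domain (open set), $\partial_\eta$ is the derivative in the direction normal to $\partial\mathcal O$, and $r:\bar{\mathcal O}\to\mathbb R$ is a continuous function. $\lambda_1=\lambda_1(-\Delta+r\,\mathrm{Id})$ denotes the first (principal) eigenvalue of $-\Delta+r\,\mathrm{Id}$ on $\mathcal O$ with Neumann boundary condition, and $v_1>0$ the associated first eigenfunction, normalized by $\int_{\mathcal O}v_1=1$; thus $-\Delta v_1+rv_1=\lambda_1v_1$ in $\mathcal O$ and $\partial_\eta v_1=0$ on $\partial\mathcal O$ (in the strong sense: $v_1\in W^{2,p}(\mathcal O)$ for all $p<\infty$, equation satisfied almost everywhere). Standing assumptions: $\lambda_1(-\Delta+r\,\mathrm{Id})<0$, and there exists $x_0\in\mathcal O$ with $r(x_0)>0$. The constant $c>0$ is defined by $$-c:=\inf_{\varepsilon>0}\ \sup_{x\in\mathcal O}\left\{\varepsilon\lambda_1v_1(x)+\tfrac12\varepsilon^2|\nabla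 v_1(x)|^2\right\}.$$ The infimum over $\varepsilon>0$ is attained at some $\bar\varepsilon>0$, and $\tilde w:=\bar\varepsilon v_1$. *)

(* Defs.v *)
(* The space R^d is ['rV[R]_d] with R : realType; its topology is that of the
   sup norm, whereas lengths of gradients and normals are Euclidean ([normsq]). *)
From HB Require Import structures.
From mathcomp Require Import all_boot all_order all_algebra.
From mathcomp Require Import all_classical all_reals all_analysis.
Set Implicit Arguments.
Unset Strict Implicit.
Unset Printing Implicit Defensive.
Import Order.TTheory GRing.Theory Num.Theory.
Import numFieldNormedType.Exports.
Local Open Scope classical_set_scope.
Local Open Scope ring_scope.

(* The sigma-algebra generated by the coordinates, as the library does for
   tuples; it coincides with the Borel sigma-algebra of R^d. *)
Definition measure_row_display : measure_display -> measure_display.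
Proof. exact. Qed.

Section measurable_row.
Context (R : realType) (d : nat).

Let coor : 'I_d -> 'rV[R]_d -> measurableTypeR R := fun i x => x ord0 i.

Let row_set0 : g_sigma_preimage coor set0.
Proof. exact: sigma_algebra0. Qed.

Let row_setC A : g_sigma_preimage coor A -> g_sigma_preimage coor (~` A).
Proof. exact: sigma_algebraC. Qed.

Let row_bigcup (F : _^nat) : (forall i, g_sigma_preimage coor (F i)) ->
  g_sigma_preimage coor (\bigcup_i (F i)).
Proof. exact: sigma_algebra_bigcup. Qed.

HB.instance Definition _ :=
  @isMeasurable.Build (measure_row_display default_measure_display)
    'rV[R]_d (g_sigma_preimage coor) row_set0 row_setC row_bigcup.

Lemma measurable_coord (i : 'I_d) :
  measurable_fun [set: 'rV[R]_d] (fun x => x ord0 i : measurableTypeR R).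
Proof.
move=> _ Y mY; rewrite setTI; apply: sub_sigma_algebra => /=.
rewrite -bigcup_seq/=; exists i => /=; first by rewrite mem_index_enum.
by exists Y => //; rewrite setTI.
Qed.

Lemma measurable_fun_row d1 (T : measurableType d1) (f : T -> 'rV[R]_d) :
  (forall i, measurable_fun [set: T] (fun t => f t ord0 i : measurableTypeR R)) ->
  measurable_fun [set: T] f.
Proof.
move=> mf _ A mA; rewrite setTI.
suff : g_sigma_preimage coor `<=` [set B | measurable (f @^-1` B)] by exact.
apply: smallest_sub.
  split=> //=; first by rewrite preimage_set0.
  - by move=> B mB; rewrite setTD preimage_setC; exact: measurableC.
  - by move=> F mF; rewrite preimage_bigcup; exact: bigcup_measurable.
rewrite -bigcup_seq/=; apply: bigcup_sub => i _ B [Y mY <-] /=.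
rewrite setTI -comp_preimage.
by have := mf i measurableT _ mY; rewrite setTI.
Qed.

End measurable_row.

Definition row_cons (R : realType) (n : nat) (p : measurableTypeR R * 'rV[R]_n) :
    'rV[R]_n.+1 :=
  \row_(i < n.+1) if unlift ord0 i is Some j then p.2 ord0 j else p.1.

Section lebesgue_row.
Context (R : realType).

Lemma row_cons0 n (p : measurableTypeR R * 'rV[R]_n) : row_cons p ord0 ord0 = p.1.
Proof. by rewrite mxE unlift_none. Qed.

Lemma row_consS n (p : measurableTypeR R * 'rV[R]_n) j :
  row_cons p ord0 (lift ord0 j) = p.2 ord0 j.
Proof. by rewrite mxE liftK. Qed.

Lemma measurable_row_cons n : measurable_fun setT (@row_cons R n).
Proof.
apply: measurable_fun_row => i; case: (unliftP ord0 i) => [j|] ->.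
- rewrite (_ : (fun _ => _) =
    (fun x : 'rV[R]_n => x ord0 j : measurableTypeR R) \o snd).
    apply: measurableT_comp; [exact: measurable_coord|exact: measurable_snd].
  by apply/funext => p /=; rewrite row_consS.
- rewrite (_ : (fun _ => _) = fst); first exact: measurable_fst.
  by apply/funext => p /=; rewrite row_cons0.
Qed.

Let row_uncons n (x : 'rV[R]_n.+1) : measurableTypeR R * 'rV[R]_n :=
  (x ord0 ord0, \row_j x ord0 (lift ord0 j)).

Let measurable_row_uncons n : measurable_fun setT (@row_uncons n).
Proof.
apply/measurable_fun_pairP; split; first exact: measurable_coord.
apply: measurable_fun_row => i.
rewrite (_ : (fun _ => _) =
  (fun x : 'rV[R]_n.+1 => x ord0 (lift ord0 i) : measurableTypeR R)).
  exact: measurable_coord.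
by apply/funext => x /=; rewrite mxE.
Qed.

Let row_consK n : cancel (@row_cons R n) (@row_uncons n).
Proof.
move=> [a x]; rewrite /row_uncons row_cons0; congr pair.
by apply/rowP => j; rewrite mxE row_consS.
Qed.

Section step.
Context (n : nat) (m : {sigma_finite_measure set 'rV[R]_n -> \bar R}).

Definition lebesgue_row_step : set 'rV[R]_n.+1 -> \bar R :=
  pushforward (@lebesgue_measure R \x m)%E (@row_cons R n).

Let step0 : lebesgue_row_step set0 = 0%E.
Proof. by rewrite /lebesgue_row_step /pushforward preimage_set0 measure0. Qed.

Let step_ge0 A : (0 <= lebesgue_row_step A)%E.
Proof. by rewrite /lebesgue_row_step /pushforward; exact: measure_ge0. Qed.

Let step_sigma_additive : semi_sigma_additive lebesgue_row_step.
Proof.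
have mf := @measurable_row_cons n.
exact: (@measure_semi_sigma_additive _ _ _
  (pushforward (@lebesgue_measure R \x m)%E (@row_cons R n))).
Qed.

HB.instance Definition _ := isMeasure.Build _ _ _ lebesgue_row_step
  step0 step_ge0 step_sigma_additive.

Let step_sigma_finite : sigma_finite setT lebesgue_row_step.
Proof.
have [F TF mF] := sigma_finiteT (@lebesgue_measure R).
have [G TG mG] := sigma_finiteT m.
pose E (k : nat * nat) := @row_uncons n @^-1` (F k.1 `*` G k.2).
have [f surjf] : exists f : nat -> nat * nat, forall k, exists i, f i = k.
  exists (fun i => odflt (0, 0)%N (unpickle i)) => k.
  by exists (pickle k); rewrite pickleK.
exists (E \o f).
  rewrite eqEsubset; split=> // x _.
  have [i _ Fi] : (\bigcup_i F i) (x ord0 ord0) by rewrite -TF.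
  have [j _ Gj] : (\bigcup_j G j) (\row_j x ord0 (lift ord0 j)) by rewrite -TG.
  by have [k fk] := surjf (i, j); exists k => //=; rewrite fk.
move=> k /=; case: (f k) => i j; rewrite /E /=.
have [mFi Fioo] := mF i; have [mGj Gjoo] := mG j; split.
  rewrite -[X in measurable X]setTI; apply: measurable_row_uncons => //.
  exact: measurableX.
rewrite /lebesgue_row_step /pushforward -comp_preimage.
rewrite (_ : @row_uncons n \o _ = id); last exact/funext/row_consK.
by rewrite preimage_id product_measure1E// lte_mul_pinfty// ge0_fin_numE.
Qed.

HB.instance Definition _ := Measure_isSigmaFinite.Build _ _ _ lebesgue_row_step
  step_sigma_finite.

End step.

Fixpoint lebesgue_row (d : nat) : {sigma_finite_measure set 'rV[R]_d -> \bar R} :=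
  match d with
  | 0%N => \d_(0 : 'rV[R]_0)
  | n.+1 => lebesgue_row_step (lebesgue_row n)
  end.

End lebesgue_row.

Section analysis.
Context (R : realType) (d : nat).
Implicit Types (O U : set 'rV[R]_d) (f g v r rho : 'rV[R]_d -> R)
  (x eta : 'rV[R]_d) (s : seq 'I_d).

Definition partial (i : 'I_d) f : 'rV[R]_d -> R :=
  fun x => 'D_(delta_mx ord0 i) f x.

Definition partials s f : 'rV[R]_d -> R := foldr partial f s.

Definition grad f x : 'rV[R]_d := \row_i partial i f x.

Definition laplacian f x : R := \sum_(i < d) partial i (partial i f) x.

Definition normsq x : R := \sum_(i < d) x ord0 i ^+ 2.

Definition smooth_on U f := forall s x, U x -> differentiable (partials s f) x.

(* Only the values of h on the open set O matter. *)
Definition extends_to_closure O (h : 'rV[R]_d -> R) :=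
  exists2 H, {within closure O, continuous H} & forall x, O x -> h x = H x.

(* C^1 on the closure: f is C^1 in O, and f and its first derivatives extend
   continuously to the closure, the extension of f being f itself. *)
Definition C1_closure O f :=
  [/\ forall x, O x -> differentiable f x,
      {within closure O, continuous f}
    & forall i, extends_to_closure O (partial i f)].

Definition smooth_closure O f :=
  [/\ smooth_on O f,
      {within closure O, continuous f}
    & forall s, extends_to_closure O (partials s f)].

Definition boundary O := closure O `\` O°.

Definition local_defining O U rho :=
  [/\ open U, smooth_on U rho, forall x, U x -> grad rho x != 0
    & forall x, U x -> (O x <-> rho x < 0)].

Definition smooth_boundary O :=
  forall x, boundary O x -> exists U rho, U x /\ local_defining O U rho.

Definition smooth_bounded_domain O :=
  [/\ O !=set0, open O, connected O, bounded_set O & smooth_boundary O].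

Definition outer_normal O x eta :=
  exists U rho, [/\ U x, local_defining O U rho
    & eta = (Num.sqrt (normsq (grad rho x)))^-1 *: grad rho x].

(* The derivative along the outer normal eta at the boundary point x is taken
   from inside O, so that it only involves values of f on the closure of O. *)
Definition normal_derivative f x eta (l : R) :=
  t^-1 * (f x - f (x - t *: eta)) @[t --> 0^'+] --> l.

Definition neumann O f :=
  forall x eta, boundary O x -> outer_normal O x eta ->
    normal_derivative f x eta 0.

Definition test_function O (phi : 'rV[R]_d -> R) :=
  smooth_on setT phi /\
  exists K, [/\ compact K, K `<=` O & forall x, ~ K x -> phi x = 0].

Definition Lp O (p : R) f : Prop := f \_ O \in Lfun (lebesgue_row R d) p%:E.

Definition weak_derivative O s f g := forall phi, test_function O phi ->
  \int[lebesgue_row R d]_(x in O) (f x * partials s phi x) =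
  (-1) ^+ size s * \int[lebesgue_row R d]_(x in O) (g x * phi x).

Definition sobolev O (k : nat) (p : R) f :=
  Lp O p f /\ forall s, (size s <= k)%N ->
    exists2 g, Lp O p g & weak_derivative O s f g.

(* h i stands for the weak derivative d_i d_i v. *)
Definition strong_eigen_equation O r (lambda : R) v :=
  exists h : 'I_d -> 'rV[R]_d -> R,
    (forall i, Lp O 1 (h i) /\ weak_derivative O [:: i; i] v (h i)) /\
    {ae lebesgue_row R d, forall x, O x ->
      - (\sum_(i < d) h i x) + r x * v x = lambda * v x}.

(* Strong eigenfunctions, of class W^{2,p} for all finite p. By Sobolev
   embedding such a function has a C^1 representative on the closure of the
   smooth domain O; this is the representative that v denotes, so that its
   gradient and normal derivative make sense pointwise. *)
Definition neumann_eigenfunction O r (lambda : R) v :=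
  [/\ forall p : R, 1 <= p -> sobolev O 2 p v,
      C1_closure O v,
      strong_eigen_equation O r lambda v,
      neumann O v
    & exists2 x, O x & v x != 0].

(* The operator being self-adjoint, its eigenvalues are real. *)
Definition first_eigenvalue O r (lambda : R) :=
  (exists v, neumann_eigenfunction O r lambda v) /\
  forall (kappa : R) w, neumann_eigenfunction O r kappa w -> lambda <= kappa.

Definition first_eigenfunction O r (lambda : R) v :=
  [/\ neumann_eigenfunction O r lambda v,
      forall x, O x -> 0 < v x
    & \int[lebesgue_row R d]_(x in O) v x = 1].

Definition sup_level O (lambda : R) v (eps : R) : \bar R :=
  ereal_sup [set (eps * lambda * v x + 2^-1 * eps ^+ 2 * normsq (grad v x))%:E
            | x in O].

Definition inf_sup_level O (lambda : R) v : \bar R :=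
  ereal_inf [set sup_level O lambda v eps | eps in [set eps | 0 < eps]].

End analysis.

(* Main.v *)
(* Write w = epsbar v1 and let k be the maximum of (u - w) / (v - w) over the
   closure of O; the claim is k <= 1.  Otherwise put th = 1/k < 1 and
   z = v - th u - (1 - th) w, so that z >= 0 vanishes somewhere.  By the choice of
   epsbar, w is a subsolution with right-hand side -c <= g, hence by convexity of
   p |-> |p|^2 / 2 so is th u + (1 - th) w with right-hand side g, and z satisfies
   -lap z + b . grad z + r z >= 0 with b bounded.  The Hopf lemma and the Neumann
   conditions exclude a zero of z on the boundary only, and the strong maximum
   principle then gives z = 0 in O.  Equality in the convexity inequality forces
   grad u = grad w = grad v, so that lap u = lap v and r (u - v) <= 0; this
   contradicts u > v at a point where r > 0.
   As v1 has only weak second derivatives, the inequality for z is used in the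
   viscosity sense.  The distributional Laplacian of v1 being the continuous
   function (r - lambda1) v1, mollifying v1 shows that it is bounded above by the
   Laplacian of any C^2 function touching v1 from above. *)
Require Import Defs.
From mathcomp Require Import all_boot all_order all_algebra.
From mathcomp Require Import all_classical all_reals all_analysis.
From mathcomp Require Import measurable_realfun ring lra.
Import Order.TTheory GRing.Theory Num.Theory.
Import numFieldNormedType.Exports.
Local Open Scope classical_set_scope.
Local Open Scope ring_scope.

Set Implicit Arguments.
Unset Strict Implicit.
Unset Printing Implicit Defensive.

(** * Smooth bump functions *)

(** A direct comparison of [u] and [v] fails because [r] changes sign: at a positive maximum of u -
    v the term r (u - v) may be negative. Measuring relative to w makes z nonnegative with minimum
    0, and then r z <= C |z| is all that the Hopf lemma and the maximum principle ask, whatever the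
    sign of [r]. Hence the form B sum |G i| + C |z| in [supersolution]; the drift b is grad v. The
    function w enters z with a negative coefficient, so a function below z that touches it yields a
    function above v1 that touches it, which is the side on which the Laplacian of v1 is controlled.
    The measure [lebesgue_row] is an iterated product and derivatives are taken along coordinates.
    Kernels are therefore products of functions of one variable: differentiating acts on one factor,
    and the total mass is a power of a one-dimensional integral. Balls for barriers must be
    Euclidean, while the norm of the space is the sup norm. Such balls are described by [normsq],
    without square roots, and [norm_le_normsq] passes to the sup norm. *)

Section bump.
Context (R : realType).

(** The factor t^-n makes the family of these functions stable under derivation up to linear
    combinations, so one derivative formula for all n gives the smoothness of e^(-1/t). *)
Definition flat (n : nat) (t : R) : R :=
  if 0 < t then t ^- n * expR (- t^-1) else 0.

Lemma flat_ge0 n t : 0 <= flat n t.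
Proof.
rewrite /flat; case: ifPn => // t0.
by rewrite mulr_ge0 ?expR_ge0// invr_ge0 exprn_ge0// ltW.
Qed.

Lemma flat0_le1 t : flat 0 t <= 1.
Proof.
rewrite /flat; case: ifPn => // t0.
by rewrite expr0 invr1 mul1r expR_le1// oppr_le0 invr_ge0 ltW.
Qed.

(* e^(1/t) >= (1/(N t))^N with N = n + 2 *)
Lemma flat_bound n (t : R) : 0 < t ->
  flat n t <= n.+2%:R ^+ n.+2 * t ^+ 2.
Proof.
move=> t0; rewrite /flat t0.
have N0 : (0 : R) < n.+2%:R by rewrite ltr0n.
have h : (n.+2%:R * t) ^- n.+2 <= expR t^-1.
  rewrite (_ : t^-1 = n.+2%:R * (n.+2%:R * t)^-1); last first.
    by rewrite invfM mulVKf// gt_eqF.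
  rewrite expRM_natl -exprVn lerXn2r//.
  - by rewrite nnegrE invr_ge0 mulr_ge0 ?ltW.
  - by rewrite nnegrE expR_ge0.
  - by rewrite (le_trans _ (expR_ge1Dx _))// lerDr.
rewrite expRN -invfM.
have NX : 0 < n.+2%:R ^+ n.+2 :> R by exact: exprn_gt0.
rewrite invf_ple ?posrE ?(mulr_gt0 NX) ?mulr_gt0 ?exprn_gt0 ?expR_gt0//.
have hm : t ^+ n * (n.+2%:R * t) ^- n.+2 <= t ^+ n * expR t^-1.
  by rewrite ler_wpM2l// exprn_ge0// ltW.
apply: le_trans hm; rewrite exprMn.
suff gen (A : R) : 0 < A -> (A * t ^+ 2)^-1 <= t ^+ n * (A * t ^+ n.+2)^-1.
  exact/gen/exprn_gt0.
move=> A0; rewrite -(addn2 n) exprD le_eqVlt; apply/orP; left; apply/eqP.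
have : t ^+ n != 0 by rewrite expf_neq0// gt_eqF.
by move: (t ^+ n) => B B0; field; rewrite B0 !gt_eqF.
Qed.

(** Away from 0 this is calculus. At 0 the quadratic bound [flat_bound] makes the difference
    quotient O(|h|), so the derivative there is 0. *)
Lemma is_derive_flat n (t : R) :
  is_derive t 1 (flat n) (flat n.+2 t - n%:R * flat n.+1 t).
Proof.
have [t0|t0|->] := ltgtP t 0.
- rewrite /flat !ltNge (ltW t0)/= mulr0 subr0.
  apply: (@near_eq_is_derive _ _ _ (cst 0)) => //.
    near=> s; rewrite /flat/= ltNge ifF//; apply/negbF/ltW.
    by near: s; exact: lt_nbhsl.
- rewrite /flat t0.
  have tn : t != 0 by rewrite gt_eqF.
  have dV : is_derive t 1 (fun s : R => s^-1) (- t ^- 2).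
    by apply: (is_derive_eq (is_deriveV tn (is_derive_id t 1))); rewrite [LHS]mulr1.
  have dE : is_derive t 1 (fun s : R => expR (- s^-1)) (expR (- t^-1) * t ^- 2).
    have := @is_derive1_comp R expR (- GRing.inv) t _ _ (is_derive_expR _) (is_deriveN dV).
    by rewrite opprK.
  have dn : is_derive t 1 (fun s : R => s ^- n) (- n%:R * t ^- n.+1).
    have -> : (fun s : R => s ^- n) = (fun s : R => s^-1) ^+ n.
      by apply/funext => s; rewrite fctE exprVn.
    apply: (is_derive_eq (is_deriveX n dV)); rewrite /GRing.scale/=.
    case: (n) => [|k] /=; first by rewrite mulr0n !oppr0 !mul0r.
    by rewrite exprVn !exprS; field; rewrite tn expf_neq0.
  have dne : is_derive t 1 (fun s : R => s ^- n * expR (- s^-1))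
      (t ^- n.+2 * expR (- t^-1) - n%:R * (t ^- n.+1 * expR (- t^-1))).
    apply: (is_derive_eq (is_deriveM dn dE)); rewrite /GRing.scale/=.
    by rewrite !exprS; field; rewrite tn expf_neq0.
  apply: near_eq_is_derive dne; near=> s; rewrite /flat ifT//.
  by near: s; exact: lt_nbhsr.
rewrite /flat ltxx mulr0 subr0.
have C0 h : `|flat n h| <= n.+2%:R ^+ n.+2 * h ^+ 2.
  rewrite ger0_norm ?flat_ge0//; have [h0|h0] := ltP 0 h; first exact: flat_bound.
  rewrite /flat ltNge h0; apply: mulr_ge0; last exact: sqr_ge0.
  exact/exprn_ge0/ler0n.
have cv : h^-1 *: ((flat n \o shift 0) (h *: 1) - flat n 0) @[h --> 0^'] --> (0 : R).
  apply/cvgr0Pnorm_le => e e0; near=> h.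
  have h0 : h != 0 by near: h; exact: nbhs_dnbhs_neq.
  rewrite /= addr0 [_%:A]mulr1 {2}/flat ltxx subr0 normrM normfV.
  rewrite ler_pdivrMl ?normr_gt0// (le_trans (C0 _))//.
  rewrite -(real_normK (num_real h)) expr2 mulrA mulrC ler_wpM2l//.
  rewrite -ler_pdivlMl ?exprn_gt0//; near: h; apply: dnbhs0_le.
  by rewrite mulr_gt0 ?invr_gt0 ?exprn_gt0.
by apply: DeriveDef; [apply/cvg_ex; exists 0|exact/cvg_lim].
Unshelve. all: by end_near. Qed.

(** A class that contains the bump and is stable under derivation, so that derivatives of every
    order exist by induction. *)
Inductive bump_span (e : R) : (R -> R) -> Prop :=
| bump_span_flat m n : bump_span e (fun t => flat m (e - t) * flat n (e + t))
| bump_spanD f g : bump_span e f -> bump_span e g ->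
    bump_span e (fun t => f t + g t)
| bump_spanZ a f : bump_span e f -> bump_span e (fun t => a * f t).

Lemma bump_span_derive e f : bump_span e f ->
  exists2 f', bump_span e f' & forall t : R, is_derive t 1 f (f' t).
Proof.
elim=> [m n|f1 f2 _ [g1 s1 d1] _ [g2 s2 d2]|a f1 _ [g1 s1 d1]].
- exists (fun t => (-1 * (flat m.+2 (e - t) * flat n (e + t)) +
      m%:R * (flat m.+1 (e - t) * flat n (e + t))) +
    (flat m (e - t) * flat n.+2 (e + t) +
     - n%:R * (flat m (e - t) * flat n.+1 (e + t)))).
    do 2 apply: bump_spanD; try apply: bump_spanZ; exact: bump_span_flat.
  move=> t.
  have dl : is_derive t 1 (fun s => e - s) (-1).
    by apply: (is_derive_eq (is_deriveB (is_derive_cst e t 1) (is_derive_id t 1))); rewrite sub0r.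
  have dr : is_derive t 1 (fun s => e + s) 1.
    by apply: (is_derive_eq (is_deriveD (is_derive_cst e t 1) (is_derive_id t 1))); rewrite add0r.
  have dl' := @is_derive1_comp R (flat m) _ t _ _ (is_derive_flat m _) dl.
  have dr' := @is_derive1_comp R (flat n) _ t _ _ (is_derive_flat n _) dr.
  apply: (is_derive_eq (is_deriveM dl' dr')).
  by rewrite /GRing.scale/=; ring.
- exists (fun t => g1 t + g2 t); first exact: bump_spanD.
  by move=> t; have := is_deriveD (d1 t) (d2 t).
- exists (fun t => a * g1 t); first exact: bump_spanZ.
  by move=> t; have := is_deriveZ a (d1 t).
Qed.

Definition smooth1 (f : R -> R) := forall n (t : R), derivable (derive1n n f) t 1.

Lemma smooth1_derive1 f : smooth1 f -> smooth1 (derive1 f).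
Proof. by move=> sf n t; rewrite -derive1Sn; exact: sf. Qed.

Lemma smooth1_derivable f t : smooth1 f -> derivable f t 1.
Proof. by move/(_ 0%N t). Qed.

Lemma smooth1_continuous f : smooth1 f -> continuous f.
Proof.
by move=> sf t; apply/differentiable_continuous/derivable1_diffP/(sf 0%N).
Qed.

Lemma bump_span_smooth1 e f : bump_span e f -> smooth1 f.
Proof.
move=> sf n; have : bump_span e (derive1n n f).
  elim: n => [//|n /bump_span_derive[g sg dg]].
  rewrite derive1nS (_ : derive1 _ = g)//; apply/funext => t.
  by rewrite derive1E; have [_ ->] := dg t.
by move=> /bump_span_derive[g _ dg] t; have [] := dg t.
Qed.

Definition is_bump (e : R) (b : R -> R) :=
  [/\ smooth1 b, forall t, 0 <= b t <= 1, forall t, e <= `|t| -> b t = 0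
    & 0 < b 0].

Lemma bump_exists e : 0 < e -> exists b, is_bump e b.
Proof.
move=> e0; exists (fun t => flat 0 (e - t) * flat 0 (e + t)); split.
- exact: bump_span_smooth1 (bump_span_flat e 0 0).
- by move=> t; rewrite mulr_ge0 ?flat_ge0//= mulr_ile1 ?flat_ge0 ?flat0_le1.
- move=> t; rewrite ler_normr /flat => /orP[et|et].
    by rewrite subr_gt0 ltNge et mul0r.
  by rewrite mulrC ltNge -lerBrDl sub0r lerNr et mul0r.
- by rewrite subr0 addr0 /flat e0 !mulr_gt0 ?expR_gt0 ?invr_gt0 ?exprn_gt0.
Qed.

Lemma derive1n_support e (f : R -> R) n : (forall t, e <= `|t| -> f t = 0) ->
  forall t, e < `|t| -> derive1n n f t = 0.
Proof.
move=> f0; elim: n => [t et|n IHn t et]; first by rewrite derive1n0 f0// ltW.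
rewrite derive1nS derive1E (near_eq_derive _ (g := cst 0)) ?derive_cst//.
near=> s; rewrite IHn//; near: s.
exact: (cvgr_norm_gt t cvg_id).
Unshelve. all: by end_near. Qed.

Lemma smooth1_support_bounded e (f : R -> R) n : smooth1 f ->
  (forall t, e <= `|t| -> f t = 0) -> exists2 M, 0 < M & forall t, `|derive1n n f t| <= M.
Proof.
move=> sf f0.
(* The sign of e is unknown; its absolute value keeps the interval nonempty. *)
have cf : {within `[- `|e|, `|e|], continuous (fun t => `|derive1n n f t|)}.
  apply: continuous_subspaceT => t; apply: cvg_norm.
  exact/differentiable_continuous/derivable1_diffP/sf.
have [|c _ cM] := EVT_max _ cf; first by rewrite ge0_cp ?normr_ge0.
exists (`|derive1n n f c| + 1); first by rewrite ltr_wpDl.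
move=> t; have [te|te] := leP `|t| `|e|.
  by rewrite (le_trans (cM t _)) ?lerDl// in_itv/= -ler_norml.
rewrite (derive1n_support n f0) ?normr0 ?addr_ge0//.
exact: le_lt_trans (ler_norm e) te.
Qed.

End bump.

(** * Directional derivatives along lines, and estimates for finite products *)

Section line.
Context (R : realType) (V : normedModType R).
Implicit Types (f : V -> R) (x v : V).

Lemma is_derive_line f x v (t df : R) :
  is_derive t 1 (fun s : R => f (s *: v + x)) df <-> is_derive (t *: v + x) v f df.
Proof.
have E : (fun h : R => h^-1 *: (((fun s : R => f (s *: v + x)) \o shift t) (h *: 1)
      - f (t *: v + x))) =
    (fun h : R => h^-1 *: ((f \o shift (t *: v + x)) (h *: v) - f (t *: v + x))).
  by apply/funext => h /=; rewrite [h *: 1]mulr1 scalerDl addrA.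
split=> -[df1 df2]; apply: DeriveDef.
- by rewrite /derivable -E.
- by rewrite /derive -E.
- by rewrite /derivable E.
- by rewrite /derive E.
Qed.

Lemma is_derive_line0 f x v (df : R) :
  is_derive (0 : R) 1 (fun s : R => f (s *: v + x)) df <-> is_derive x v f df.
Proof. by rewrite is_derive_line scale0r add0r. Qed.

End line.

Lemma derive1_val (R : realType) (f : R -> R) (t df : R) :
  is_derive t 1 f df -> derive1 f t = df.
Proof. by rewrite derive1E => -[_ ->]. Qed.

Section prod.
Context (R : realType).

(** Telescoping: the factors are exchanged one at a time, the other ones being at most 1 in absolute
    value. *)
Lemma prod_dist (I : Type) (r : seq I) (a b : I -> R) :
  (forall i, `|a i| <= 1) -> (forall i, `|b i| <= 1) ->
  `|\prod_(i <- r) a i - \prod_(i <- r) b i| <= \sum_(i <- r) `|a i - b i|.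
Proof.
move=> a1 b1; elim: r => [|i r IHr]; first by rewrite !big_nil subrr normr0.
rewrite !big_cons.
have A1 : `|\prod_(j <- r) a j| <= 1.
  by rewrite normr_prod; apply: prodr_ile1 => j _; rewrite normr_ge0 a1.
rewrite (_ : _ - _ = (a i - b i) * \prod_(j <- r) a j +
  b i * (\prod_(j <- r) a j - \prod_(j <- r) b j)); last by ring.
rewrite (le_trans (ler_normD _ _))// !normrM lerD//.
  by rewrite ler_piMr.
by rewrite (le_trans _ IHr)// ler_piMl.
Qed.

Lemma prod_bounded (I : Type) (r : seq I) (c : I -> R -> R) :
  (forall i, exists M, forall t, `|c i t| <= M) ->
  exists2 M, 0 < M & forall a : I -> R, `|\prod_(i <- r) c i (a i)| <= M.
Proof.
move=> cM; elim: r => [|i r [M M0 IHr]].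
  by exists 1 => // a; rewrite big_nil normr1.
have [N cN] := cM i; exists ((`|N| + 1) * M); first by rewrite mulr_gt0// ltr_wpDl.
move=> a; rewrite big_cons normrM ler_pM//.
by rewrite (le_trans (cN _))// (le_trans (ler_norm _))// lerDl.
Qed.

End prod.

(** * Mollification by tensor products *)

Section tensor.
Context (R : realType) (d : nat).
Implicit Types (g c : 'I_d -> R -> R) (x y z : 'rV[R]_d).

Definition tensor g z : R := \prod_i g i (z ord0 i).

Definition derive_at g k : 'I_d -> R -> R :=
  fun i => if i == k then derive1 (g i) else g i.

Definition smooth_family g := forall i, smooth1 (g i).

Lemma smooth_family_derive_at g k : smooth_family g -> smooth_family (derive_at g k).
Proof. by move=> sg i; rewrite /derive_at; case: ifP => _; [exact: smooth1_derive1|]. Qed.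

Lemma differentiable_tensor g x : (forall i t, derivable (g i) t 1) ->
  differentiable (tensor g) x.
Proof.
move=> dg; rewrite /tensor; elim: index_enum => [|i r IHr].
  rewrite (_ : (fun _ => _) = cst 1); first exact: differentiable_cst.
  by apply/funext => z; rewrite big_nil.
rewrite (_ : (fun _ => _) =
  (g i \o (fun z : 'rV[R]_d => z ord0 i)) * (fun z => \prod_(j <- r) g j (z ord0 j))).
  apply: differentiableM => //; apply: differentiable_comp.
    exact: differentiable_coord.
  exact/derivable1_diffP.
by apply/funext => z; rewrite big_cons fctE.
Qed.

Lemma is_derive_tensor g k x : (forall i t, derivable (g i) t 1) ->
  is_derive x (delta_mx ord0 k) (tensor g) (tensor (derive_at g k) x).
Proof.
move=> sg; apply/is_derive_line0.
have -> : (fun s => tensor g (s *: delta_mx ord0 k + x)) =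
    (\prod_(i < d | i != k) g i (x ord0 i)) \*: (g k \o (+%R^~ (x ord0 k))).
  apply/funext => s; rewrite /tensor (bigD1 k)//= !mxE !eqxx mulr1 mulrC.
  congr (_ * _); apply: eq_bigr => i ik.
  by rewrite !mxE eqxx (negbTE ik) mulr0 add0r.
have dg : is_derive (0 + x ord0 k) 1 (g k) (derive1 (g k) (x ord0 k)).
  by rewrite add0r derive1E; apply/derivableP.
have dk := is_derive1_comp (x := 0) dg (is_derive_shift _ _ _).
apply: (is_derive_eq (is_deriveZ _ dk)).
rewrite mulr1 /tensor /derive_at [RHS](bigD1 k)//= eqxx [LHS]mulrC; congr (_ * _).
by apply: eq_bigr => i /negbTE ->.
Qed.

Lemma partial_tensor g k : smooth_family g -> partial k (tensor g) = tensor (derive_at g k).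
Proof.
move=> sg; apply/funext => x; rewrite /partial.
by have [_ ->] := is_derive_tensor k x (fun i t => smooth1_derivable (sg i)).
Qed.

(** Iterated partial derivatives never leave the class of tensors, so the smoothness of a tensor
    reduces to the differentiability of tensors. *)
Lemma partials_tensor s g : smooth_family g ->
  exists2 h, smooth_family h & partials s (tensor g) = tensor h.
Proof.
move=> sg; elim: s => [|k s [h sh /= ->]]; first by exists g.
by exists (derive_at h k); [exact: smooth_family_derive_at|exact: partial_tensor].
Qed.

Lemma smooth_on_tensor g : smooth_family g -> smooth_on setT (tensor g).
Proof.
move=> sg s x _; have [h sh ->] := partials_tensor s sg.
by apply: differentiable_tensor => i t; exact: smooth1_derivable.
Qed.

End tensor.

Section kernel.
Context (R : realType) (d : nat).
Implicit Types (c : 'I_d -> R -> R) (x y z : 'rV[R]_d).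

Lemma is_derive1_translate (f : R -> R) a (t : R) : derivable f (t - a) 1 ->
  is_derive t 1 (fun s => f (s - a)) (derive1 f (t - a)).
Proof.
move=> df; have dg : is_derive (t - a) 1 f (derive1 f (t - a)).
  by rewrite derive1E; exact/derivableP.
have := is_derive1_comp (g := shift (- a)) dg (is_derive_shift _ _ _).
by rewrite mulr1.
Qed.

Lemma is_derive1_reflect (f : R -> R) a (t : R) : derivable f (a - t) 1 ->
  is_derive t 1 (fun s => f (a - s)) (- derive1 f (a - t)).
Proof.
move=> df; have dg : is_derive (a - t) 1 f (derive1 f (a - t)).
  by rewrite derive1E; exact/derivableP.
have da : is_derive t 1 (fun s : R => a - s) (-1).
  by apply: (is_derive_eq (is_deriveB (is_derive_cst a t 1) (is_derive_id t 1)));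
    rewrite sub0r.
by have := is_derive1_comp (g := fun s => a - s) dg da; rewrite mulrN1.
Qed.

Lemma derive1n_translate (f : R -> R) a n : smooth1 f ->
  derive1n n (fun s => f (s - a)) = fun s => derive1n n f (s - a).
Proof.
move=> sf; elim: n => [//|n IHn]; rewrite !derive1nS IHn; apply/funext => t.
exact/derive1_val/is_derive1_translate/sf.
Qed.

Lemma smooth1_translate (f : R -> R) a : smooth1 f -> smooth1 (fun s => f (s - a)).
Proof.
move=> sf n t; rewrite derive1n_translate//.
by have [] := is_derive1_translate (sf n (t - a)).
Qed.

(** The centre is y and the integration variable z. A derivative in y is minus the derivative in z;
    for second derivatives the two signs cancel, and the kernel can serve as a test function in
    z. *)
Definition kern c y z : R := \prod_i c i (z ord0 i - y ord0 i).

Lemma kern_tensor c y : kern c y = tensor (fun i t => c i (t - y ord0 i)).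
Proof. by []. Qed.

Lemma derive_at_translate c y k : smooth_family c ->
  derive_at (fun i t => c i (t - y ord0 i)) k =
  fun i t => derive_at c k i (t - y ord0 i).
Proof.
move=> sc; apply/funext => i; rewrite /derive_at; case: ifP => // _.
by apply/funext => t; apply/derive1_val/is_derive1_translate/smooth1_derivable.
Qed.

Lemma smooth_family_translate c y : smooth_family c ->
  smooth_family (fun i t => c i (t - y ord0 i)).
Proof. by move=> sc i; exact: smooth1_translate. Qed.

Lemma smooth_on_kern c y : smooth_family c -> smooth_on setT (kern c y).
Proof.
move=> sc; have st := smooth_family_translate (y := y) sc.
exact: (smooth_on_tensor st).
Qed.

Lemma partial_kern c y k : smooth_family c ->
  partial k (kern c y) = kern (derive_at c k) y.
Proof.
move=> sc; rewrite kern_tensor partial_tensor ?derive_at_translate//.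
exact: smooth_family_translate.
Qed.

Lemma is_derive_kern c k y z : smooth_family c ->
  is_derive y (delta_mx ord0 k) (fun y => kern c y z) (- kern (derive_at c k) y z).
Proof.
move=> sc.
have dc i t : is_derive (t : R) 1 (fun s => c i (z ord0 i - s))
    (- derive1 (c i) (z ord0 i - t)).
  exact/is_derive1_reflect/smooth1_derivable.
have dc' i t : derivable (fun s : R => c i (z ord0 i - s)) t 1 by have [] := dc i t.
apply: (is_derive_eq (is_derive_tensor k y dc')).
rewrite /tensor /kern (bigD1 k)//= [in RHS](bigD1 k)//= /derive_at eqxx -mulNr.
congr (_ * _); first exact: derive1_val.
by apply: eq_bigr => i /negbTE ->.
Qed.

Definition bounded_family c :=
  forall i n, exists M, forall t, `|derive1n n (c i) t| <= M.

Lemma bounded_family_derive_at c k : bounded_family c -> bounded_family (derive_at c k).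
Proof.
move=> bc i n; rewrite /derive_at; case: ifP => _; last exact: bc.
by rewrite -derive1Sn; exact: bc.
Qed.

Lemma kern_bounded c : bounded_family c ->
  exists2 M, 0 < M & forall y z, `|kern c y z| <= M.
Proof.
move=> bc; have [M M0 cM] := prod_bounded (index_enum 'I_d) (fun i => bc i 0%N).
by exists M => // y z; exact: (cM (fun i => z ord0 i - y ord0 i)).
Qed.

Lemma measurable_kern c y : smooth_family c ->
  measurable_fun [set: 'rV[R]_d] (kern c y).
Proof.
move=> sc; apply: measurable_prod => i _.
apply: (@measurableT_comp _ _ _ _ _ _ (c i \o (fun t => t - y ord0 i))).
  apply: continuous_measurable_fun.
  exact/smooth1_continuous/smooth1_translate.
exact: measurable_coord.
Qed.

Local Notation mu := (lebesgue_row R d).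

Section mollification.
Variable q : 'rV[R]_d -> R.
Hypothesis iq : mu.-integrable setT (EFin \o q).

(** The kernel is not normalized; its mass appears as the factor [N] in the estimates. *)
Definition mollify c y : R := \int[mu]_z (q z * kern c y z).

Lemma integrable_kern c y : smooth_family c -> bounded_family c ->
  mu.-integrable setT (EFin \o (fun z => q z * kern c y z)).
Proof.
move=> sc bc; have [M M0 cM] := kern_bounded bc.
rewrite /comp; under eq_fun do rewrite EFinM.
apply: integrableMl => //; first exact: measurable_kern.
exists M; split; first by rewrite num_real.
by move=> N MN z _; exact: le_trans (cM y z) (ltW MN).
Qed.

(** Differentiation under the integral on the line through y in direction k. The dominating function
    is |q| times a bound of the differentiated kernel; it does not depend on the point of the line,
    so the parameter interval ]-1, 1[ is an arbitrary choice. *)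
Lemma is_derive_mollify c k y : smooth_family c -> bounded_family c ->
  is_derive y (delta_mx ord0 k) (mollify c) (- mollify (derive_at c k) y).
Proof.
move=> sc bc; apply/is_derive_line0.
have [M M0 cM] := kern_bounded (bounded_family_derive_at k bc).
pose f t z := q z * kern c (t *: delta_mx ord0 k + y) z.
have df (t : R) z : is_derive t 1 (f ^~ z)
    (- (q z * kern (derive_at c k) (t *: delta_mx ord0 k + y) z)).
  have dk := is_derive_kern k (t *: delta_mx ord0 k + y) z sc.
  move/(is_derive_line (fun y => kern c y z) y (delta_mx ord0 k) t) : dk => dk.
  by apply: (is_derive_eq (is_deriveZ (q z) dk)); rewrite -mulrN.
have I0 : `]-1, 1[%classic (0 : R) by rewrite /= in_itv/= ltrN10 ltr01.
have intf (t : R) : `]-1, 1[%classic t -> mu.-integrable setT (EFin \o f t).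
  by move=> _; exact: integrable_kern.
have derf (t : R) z : `]-1, 1[%classic t -> setT z -> derivable (f ^~ z) t 1.
  by move=> _ _; have [] := df t z.
have G0 z : 0 <= `|q z| * M by rewrite mulr_ge0// ltW.
have iG : mu.-integrable setT (EFin \o (fun z => `|q z| * M)).
  rewrite /comp; under eq_fun do rewrite EFinM.
  by apply: integrableMl => //; [exact: integrable_norm|exact: bounded_cst].
have Gub (t : R) z : `]-1, 1[%classic t -> setT z ->
    `|partial1of2 f t z| <= `|q z| * M.
  move=> _ _; rewrite /partial1of2 (derive1_val (df t z)) normrN normrM.
  by rewrite ler_wpM2l.
have dF := @derivable_under_integral R _ _ mu f setT measurableT 0 (-1) 1 I0
  intf derf _ G0 iG Gub.
have := @differentiation_under_integral R _ _ mu f setT measurableT 0 (-1) 1 I0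
  intf derf _ G0 iG Gub.
rewrite derive1E => eF.
apply: DeriveDef => //; rewrite [LHS]eF /mollify -mulN1r -RintegralZl//.
  apply: eq_Rintegral => z _.
  by rewrite /= /partial1of2 (derive1_val (df 0 z)) scale0r add0r mulN1r.
by apply: integrable_kern; [exact: smooth_family_derive_at|exact: bounded_family_derive_at].
Qed.

End mollification.
End kernel.

(** * The mass of bumps and of their tensor products *)

Section bump_integral.
Context (R : realType).
Notation leb := (@lebesgue_measure R).

Lemma integral_translate (b : R -> R) a : continuous b -> (forall t, 0 <= b t) ->
  (\int[leb]_t (b (t - a))%:E = \int[leb]_t (b t)%:E)%E.
Proof.
move=> cb b0.
have dF (t : R) : is_derive t 1 (fun s : R => s - a) 1.
  exact: is_derive_shift.
have F' : derive1 (fun s : R => s - a) = cst 1.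
  by apply/funext => t; exact: derive1_val.
rewrite [RHS](@increasing_ge0_integration_by_substitutionT R (fun s => s - a) b)//.
- by apply: eq_integral => t _; rewrite /= F' /= mulr1.
- by move=> s t st; rewrite ltrD2r.
- by rewrite F'; exact: cst_continuous.
- by rewrite F'; exact: is_cvg_cst.
- by rewrite F'; exact: is_cvg_cst.
- by apply/cvgrNyPle => A; near=> s; rewrite lerBlDr; near: s; exact: nbhs_ninfty_le (num_real _).
- by apply/cvgryPge => A; near=> s; rewrite lerBrDr; near: s; exact: nbhs_pinfty_ge (num_real _).
Unshelve. all: by end_near. Qed.

(** The integral is finite because b is at most the indicator of [-|e|, |e|], and positive because b
    >= b 0 / 2 on an interval around 0. *)
Lemma bump_integral e (b : R -> R) : is_bump e b ->
  exists2 beta : R, 0 < beta &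
    forall a, (\int[leb]_t (b (t - a))%:E = beta%:E)%E.
Proof.
move=> [sb b01 bs b0].
have cb := smooth1_continuous sb.
have mb : measurable_fun [set: R] b by exact: continuous_measurable_fun.
have bge t : 0 <= b t by have /andP[] := b01 t.
suff [beta beta0 bE] : exists2 beta : R, 0 < beta & (\int[leb]_t (b t)%:E = beta%:E)%E.
  by exists beta => // a; rewrite integral_translate.
have I1 : (\int[leb]_t (b t)%:E < +oo)%E.
  apply: (@le_lt_trans _ _ (\int[leb]_t (\1_(`[- `|e|, `|e|]%classic) t)%:E)%E).
    apply: ge0_le_integral => //.
    - by move=> t _; rewrite lee_fin.
    - exact/measurable_EFinP.
    - exact/measurable_EFinP/measurable_indic.
    - move=> t _; rewrite lee_fin indicE; case: (boolP (t \in _)) => [_|].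
        by have /andP[] := b01 t.
      rewrite notin_setE/= in_itv/= -ler_norml => /negP; rewrite -ltNge => te.
      by rewrite bs// (le_trans (ler_norm e))// ltW.
  rewrite integral_indic// setIT /= lebesgue_measure_itv/=.
  by case: ifP => // _; rewrite ltry.
have [eta /= eta0 heta] : \forall r \near 0^'+, forall t, `|t| <= r -> b 0 / 2 <= b t.
  have := cb 0; move/cvgrPdist_lt/(_ (b 0 / 2)).
  rewrite divr_gt0// => /(_ erefl) /nbhs_ballP[r /= r0 hr].
  near=> s; move=> t ts.
  have : ball (0 : R) r t.
    by rewrite -ball_normE/= sub0r normrN (le_lt_trans ts)//; near: s; exact: nbhs_right_lt.
  by move/hr; rewrite ltr_norml => /andP[_]; lra.
pose r := eta / 2.
have r0 : 0 < r by rewrite divr_gt0.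
have hr t : `|t| <= r -> b 0 / 2 <= b t.
  by apply: heta => //=; rewrite sub0r normrN gtr0_norm// /r; lra.
have I2 : (0 < \int[leb]_t (b t)%:E)%E.
  apply: (@lt_le_trans _ _ (\int[leb]_t ((b 0 / 2)%:E * (\1_(`[- r, r]%classic) t)%:E))%E).
    rewrite ge0_integralZl_EFin//; last 2 first.
    - exact/measurable_EFinP/measurable_indic.
    - by rewrite divr_ge0// ltW.
    rewrite integral_indic// setIT /= lebesgue_measure_itv/= lte_fin ifT; last by lra.
    by rewrite -EFinB -EFinM lte_fin mulr_gt0 ?divr_gt0//; lra.
  apply: ge0_le_integral => //.
  - by move=> t _; rewrite -EFinM lee_fin mulr_ge0// divr_ge0// ltW.
  - by apply/measurable_EFinP; apply: measurable_funM => //; exact: measurable_indic.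
  - exact/measurable_EFinP.
  - move=> t _; rewrite -EFinM lee_fin indicE; case: (boolP (t \in _)) => [|_]; last by rewrite mulr0.
    by rewrite inE/= in_itv/= -ler_norml mulr1 => /hr.
exists (fine (\int[leb]_t (b t)%:E)%E).
  by rewrite fine_gt0// I2 I1.
by rewrite fineK// ge0_fin_numE// ltW.
Unshelve. all: by end_near. Qed.

(** Tonelli and induction on d, following the recursion of [lebesgue_row]: a Dirac mass on R^0, then
    the image of a product under [row_cons]. *)
Lemma integral_tensor d (g : 'I_d -> R -> R) (beta : R) :
  (forall i t, 0 <= g i t) -> (forall i, measurable_fun setT (g i)) ->
  (forall i, (\int[leb]_t (g i t)%:E = beta%:E)%E) ->
  (\int[lebesgue_row R d]_z (tensor g z)%:E = (beta ^+ d)%:E)%E.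
Proof.
have mtens k (h : 'I_k -> R -> R) : (forall i, measurable_fun setT (h i)) ->
    measurable_fun [set: 'rV[R]_k] (EFin \o tensor h).
  move=> mh; apply/measurable_EFinP/measurable_prod => i _.
  by apply: (@measurableT_comp _ _ _ _ _ _ (h i)) => //; exact: measurable_coord.
elim: d g => [|d IHd] g g0 mg gb.
  rewrite integral_dirac//; last exact: mtens.
  by rewrite /tensor big_ord0 diracT mul1e.
have g'0 i t : 0 <= g (lift ord0 i) t by [].
have tensor_ge0 k (h : 'I_k -> R -> R) z : (forall i t, 0 <= h i t) -> 0 <= tensor h z.
  by move=> h0; rewrite prodr_ge0.
rewrite [LHS](ge0_integral_pushforward (@measurable_row_cons R d))//; last 2 first.
- exact: mtens.
- by move=> z _; rewrite lee_fin tensor_ge0.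
rewrite preimage_setT fubini_tonelli1//; last 2 first.
- by apply: measurableT_comp; [exact: mtens|exact: measurable_row_cons].
- by move=> z /=; rewrite lee_fin tensor_ge0.
rewrite /fubini_F exprS mulrC EFinM -(gb ord0) -ge0_integralZl//; last 3 first.
- by apply/measurable_EFinP => /=; exact: mg.
- by move=> t _; rewrite lee_fin.
- by rewrite lee_fin exprn_ge0// -lee_fin -(gb ord0) integral_ge0// => t _; rewrite lee_fin.
apply: eq_integral => t _; rewrite muleC.
rewrite -(IHd _ g'0 (fun i => mg _) (fun i => gb _)) -ge0_integralZl//; last 3 first.
- exact: mtens.
- by move=> z _; rewrite lee_fin tensor_ge0.
- by rewrite lee_fin.
apply: eq_integral => z _ /=; rewrite -EFinM; congr (_%:E).
rewrite /tensor big_ord_recl row_cons0; congr (_ * _).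
by apply: eq_bigr => i _; rewrite row_consS.
Qed.

End bump_integral.

Lemma continuous_sum_for (R : realType) (T : topologicalType) (I : Type) (r : seq I)
  (F : I -> T -> R) x : (forall i, {for x, continuous (F i)}) ->
  {for x, continuous (fun y => \sum_(i <- r) F i y)}.
Proof.
move=> cF; elim: r => [|i r IHr].
  rewrite (_ : (fun _ => _) = cst 0); first exact: cst_continuous.
  by apply/funext => y; rewrite big_nil.
rewrite (_ : (fun _ => _) = (fun y => F i y + \sum_(j <- r) F j y)).
  exact: cvgD (cF i) IHr.
by apply/funext => y; rewrite big_cons.
Qed.

(** * Sup norm against Euclidean norm, and the second derivative test *)

Section row_norm.
Context (R : realType) (d : nat).
Implicit Types (x y z : 'rV[R]_d) (e : R).

Lemma row_norm_leP x e : 0 <= e -> reflect (forall i, `|x ord0 i| <= e) (`|x| <= e).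
Proof.
move=> e0; rewrite {2}/Num.Def.normr/= mx_normrE.
apply: (iffP (bigmax_leP _ _ _ _)) => [[_ h] i|h]; first exact: (h (ord0, i)).
by split=> // -[i j] _ /=; rewrite ord1.
Qed.

Lemma coord_le_norm x i : `|x ord0 i| <= `|x|.
Proof. by move: i; exact/row_norm_leP. Qed.

Lemma normsq_ge0 x : 0 <= normsq x.
Proof. by apply: sumr_ge0 => i _; exact: sqr_ge0. Qed.

Lemma normsq0 : normsq (0 : 'rV[R]_d) = 0.
Proof. by rewrite /normsq big1// => i _; rewrite mxE expr0n. Qed.

Lemma norm_le_normsq x : `|x| ^+ 2 <= normsq x.
Proof.
rewrite -(sqr_sqrtr (normsq_ge0 x)) lerXn2r ?nnegrE ?sqrtr_ge0//.
apply/row_norm_leP; first exact: sqrtr_ge0.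
move=> i; rewrite -sqrtr_sqr ler_wsqrtr// /normsq (bigD1 i)//= lerDl.
by apply: sumr_ge0 => j _; exact: sqr_ge0.
Qed.

Lemma continuous_row_coord i : continuous (fun x => x ord0 i).
Proof. exact: coord_continuous. Qed.

Lemma continuous_normsq : continuous (@normsq R d).
Proof.
move=> x; apply: continuous_sum_for => i.
apply: (@continuous_comp _ _ _ (fun x : 'rV[R]_d => x ord0 i) (fun t => t ^+ 2)).
  exact: continuous_row_coord.
exact: exprn_continuous.
Qed.

Lemma compact_cball y e : compact [set z | `|z - y| <= e].
Proof.
apply: bounded_closed_compact.
  exists (e + `|y|); split; first exact: num_real.
  move=> M eM z /= zy; rewrite (le_trans _ (ltW eM))//.
  by rewrite -[z](subrK y) (le_trans (ler_normD _ _))// lerD2r.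
have cN : continuous (fun z => `|z - y|).
  by move=> z; exact: (cvg_norm (cvgB cvg_id (cvg_cst y))).
by move/continuous_closedP : cN => /(_ _ (@closed_le _ e)).
Qed.

End row_norm.

Section second_derivative_test.
Context (R : realType) (V : normedModType R).

(** At the maximum g vanishes. If l > 0, then g is positive on the ray from x in direction v for
    small positive times, and the mean value theorem puts m above m x there. *)
Lemma second_derivative_max (m g : V -> R) (x v : V) (l : R) :
  (\forall y \near x, is_derive y v m (g y)) -> is_derive x v g l ->
  (\forall y \near x, m y <= m x) -> l <= 0.
Proof.
move=> dm dg mx; rewrite leNgt; apply/negP => l0.
pose L t := t *: v + x.
have cL : L t @[t --> (0 : R)] --> x.
  rewrite -[X in _ --> X](_ : 0 *: v + x = x); last by rewrite scale0r add0r.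
  by apply: cvgD; [apply: cvgZ; [exact: cvg_id|exact: cvg_cst]|exact: cvg_cst].
have : \forall t \near (0 : R), is_derive (L t) v m (g (L t)) /\ m (L t) <= m x.
  near=> t; split; near: t; [exact: (cL _ dm)|exact: (cL _ mx)].
move=> /nbhs_ballP[e /= e0 he].
have {}he (t : R) : `|t| < e -> is_derive t 1 (fun s => m (L s)) (g (L t)) /\ m (L t) <= m x.
  move=> te; have [|h1 h2] := he t; first by rewrite -ball_normE/= sub0r normrN.
  by split=> //; apply/is_derive_line.
have L0 : L 0 = x by rewrite /L scale0r add0r.
have inE' (t : R) : t \in `](- e), e[ -> `|t| < e by rewrite in_itv/= -ltr_norml.
have gx0 : g x = 0.
  have dmax := @derive1_at_max R (fun s => m (L s)) (- e) e 0.
  have : is_derive (0 : R) 1 (fun s => m (L s)) 0.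
    apply: dmax; first by lra.
    - by move=> t /inE' /he[[]].
    - by rewrite in_itv/= oppr_lt0 e0.
    - by move=> t /inE' /he[_]; rewrite L0.
  have [|h _] := he 0; first by rewrite normr0.
  by move=> /derive1_val <-; rewrite (derive1_val h) L0.
have /is_derive_line0[dgL gLl] := dg.
have cv : h^-1 * g (L h) @[h --> 0^'] --> l.
  rewrite -gLl; move: dgL => /cvg_ex[k]; rewrite /derive.
  under eq_fun do rewrite /= addr0 [_%:A]mulr1 scale0r add0r gx0 subr0.
  by move=> ck; rewrite (cvg_lim _ ck)//; apply: ck.
have [r /= r0 hr] := cvgr_gt _ cv _ l0.
pose t := Num.min e r / 2.
have t0 : 0 < t by rewrite divr_gt0// lt_min e0.
have [te tr] : t < e /\ t < r.
  by rewrite /t; case: (leP e r) => er; split; lra.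
have tle (s : R) : 0 <= s <= t -> `|s| < e.
  by move=> /andP[s0 st]; rewrite ger0_norm// (le_lt_trans st).
have [||s] := @MVT R (fun s => m (L s)) (fun s => g (L s)) 0 t t0.
- move=> s; rewrite in_itv/= => /andP[s0 st].
  by have [|] := he s => //; apply: tle; rewrite !ltW.
- apply: derivable_within_continuous => s; rewrite in_itv/= => st.
  by have [|[]] := he s => //; exact: tle.
rewrite in_itv/= subr0 L0 => /andP[s0 st] mE.
have [|_] := he t; first by rewrite tle// lexx ltW.
rewrite -subr_le0 mE leNgt mulr_gt0//.
have := hr s; rewrite /= sub0r normrN gtr0_norm// => /(_ (lt_trans st tr)).
by move=> /(_ (lt0r_neq0 s0)); rewrite pmulr_rgt0// invr_gt0.
Unshelve. all: by end_near. Qed.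

End second_derivative_test.

(** * Mollification by a tensor product of bumps *)

Section bump_kernel.
Context (R : realType) (d : nat) (e : R) (b : R -> R).
Hypothesis bb : is_bump e b.
Hypothesis e0 : 0 < e.
Local Notation mu := (lebesgue_row R d).
Local Notation c := (fun _ : 'I_d => b).
Implicit Types (q : 'rV[R]_d -> R) (y z : 'rV[R]_d).

Lemma bump_smooth_family : smooth_family c.
Proof. by case: bb => sb _ _ _ i. Qed.

Lemma bump_bounded_family : bounded_family c.
Proof.
case: bb => sb _ bs _ i n.
by have [M _ bM] := smooth1_support_bounded n sb bs; exists M.
Qed.

Lemma bump_kern_ge0 y z : 0 <= kern c y z.
Proof. by case: bb => _ b01 _ _; apply: prodr_ge0 => i _; have /andP[] := b01 (z ord0 i - y ord0 i). Qed.

(** The sup norm is attained at some coordinate, and the factor with that index vanishes: the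
    support is a cube, that is, a ball of the space. *)
Lemma bump_kern_support y z : e <= `|z - y| -> kern c y z = 0.
Proof.
case: bb => _ _ bs _ ey; apply/eqP; apply/negPn/negP => k0.
have : `|z - y| < e.
  have [zy|zy] := eqVneq (z - y) 0; first by rewrite zy normr0.
  have [|[i j] zyE] := @mx_norm_neq0 _ _ _ (z - y).
    by apply: contra_neq zy; exact: mx_norm_eq0.
  rewrite [X in X < _]zyE /= ltNge; apply/negP => ej.
  move: k0; rewrite /kern (bigD1 j)//= bs ?mul0r ?eqxx//.
  by move: ej; rewrite ord1 !mxE.
by rewrite ltNge ey.
Qed.

Lemma bump_kern_integral : exists2 N : R, 0 < N &
  forall y, mu.-integrable setT (EFin \o kern c y) /\ \int[mu]_z (kern c y z) = N.
Proof.
case: (bb) => sb b01 _ _.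
have [beta beta0 bE] := bump_integral bb.
exists (beta ^+ d); first exact: exprn_gt0.
move=> y.
have iE : (\int[mu]_z (kern c y z)%:E = (beta ^+ d)%:E)%E.
  rewrite kern_tensor (integral_tensor (beta := beta))//.
    by move=> i t; have /andP[] := b01 (t - y ord0 i).
  move=> i; apply: continuous_measurable_fun.
  exact/smooth1_continuous/smooth1_translate.
split; last by rewrite /Rintegral iE.
apply/integrableP; split.
  by apply/measurable_EFinP; apply: measurable_kern; exact: bump_smooth_family.
rewrite (eq_integral (fun z => (kern c y z)%:E)) ?iE ?ltry// => z _ /=.
by rewrite ger0_norm// bump_kern_ge0.
Qed.

Lemma mollify_ge q a y N : mu.-integrable setT (EFin \o q) ->
  mu.-integrable setT (EFin \o kern c y) -> \int[mu]_z (kern c y z) = N ->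
  {ae mu, forall z, `|z - y| < e -> a <= q z} -> N * a <= mollify q c y.
Proof.
move=> iq ik kN qa.
have iqk := @integrable_kern _ _ q iq c y bump_smooth_family bump_bounded_family.
have iak : mu.-integrable setT (EFin \o (fun z => a * kern c y z)).
  by rewrite /comp; under eq_fun do rewrite EFinM; exact: integrableZl.
have ig : mu.-integrable setT (EFin \o (fun z => q z * kern c y z - a * kern c y z)).
  by rewrite /comp; under eq_fun do rewrite EFinB; exact: integrableB.
rewrite -subr_ge0 -kN mulrC -RintegralZl// /mollify -RintegralB//.
(* The integrand is nonnegative only almost everywhere, so it is exchanged for its absolute value,
   which has the same integral. *)
rewrite /Rintegral (ae_eq_integral (fun z => `|(q z * kern c y z - a * kern c y z)%:E|%E))//.
- by rewrite fine_ge0// integral_ge0.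
- exact: measurable_int ig.
- by apply: measurableT_comp => //; exact: measurable_int ig.
apply: filterS qa => z qa _; rewrite /= ger0_norm//.
rewrite -mulrBl; have [zy|zy] := ltP `|z - y| e.
  by rewrite mulr_ge0 ?subr_ge0 ?qa ?bump_kern_ge0.
by rewrite bump_kern_support// mulr0.
Qed.

Lemma mollifyN q y : mu.-integrable setT (EFin \o q) -> mollify (\- q) c y = - mollify q c y.
Proof.
move=> iq; rewrite /mollify -mulN1r -RintegralZl//; last first.
  by apply: integrable_kern => //; [exact: bump_smooth_family|exact: bump_bounded_family].
by apply: eq_Rintegral => z _; rewrite mulNr mulN1r.
Qed.

Lemma mollify_le q a y N : mu.-integrable setT (EFin \o q) ->
  mu.-integrable setT (EFin \o kern c y) -> \int[mu]_z (kern c y z) = N ->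
  (forall z, `|z - y| < e -> q z <= a) -> mollify q c y <= N * a.
Proof.
move=> iq ik kN qa.
have iNq : mu.-integrable setT (EFin \o \- q).
  by rewrite /comp; under eq_fun do rewrite /= EFinN; exact: integrableN.
rewrite -[X in X <= _]opprK -mollifyN// lerNl -mulrN mollify_ge//.
by apply: aeW => z zy; rewrite lerN2 qa.
Qed.

(** Partial derivatives alone do not give the continuity that the extreme value theorem requires. By
    [prod_dist] and the mean value theorem the kernel is Lipschitz in its centre with constant L d,
    uniformly in z; integration against |q| preserves this. *)
Lemma continuous_mollify q : mu.-integrable setT (EFin \o q) -> continuous (mollify q c).
Proof.
move=> iq; case: (bb) => sb b01 bs _.
have [L L0 bL] := smooth1_support_bounded 1 sb bs.
have lip s t : `|b s - b t| <= L * `|s - t|.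
  wlog st : s t / s < t.
    move=> H; have [/H//|/H|->] := ltgtP s t; last by rewrite !subrr normr0 mulr0.
    by rewrite distrC (distrC s).
  rewrite distrC (distrC s); have [||r _ ->] := @MVT R b (derive1 b) s t st.
  - by move=> r _; rewrite derive1E; apply/derivableP/smooth1_derivable.
  - exact/continuous_subspaceT/smooth1_continuous.
  by rewrite normrM ler_wpM2r// bL.
have kl y y' z : `|kern c y z - kern c y' z| <= L * d%:R * `|y' - y|.
  have b1 r : `|b r| <= 1.
    by have /andP[r0 r1] := b01 r; rewrite ger0_norm.
  apply: (le_trans (prod_dist _ _ _)) => [i|i|]; [exact: b1|exact: b1|].
  have -> : L * d%:R * `|y' - y| = \sum_(i < d) L * `|y' - y|.
    by rewrite sumr_const card_ord -mulrA mulrCA mulr_natl.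
  apply: ler_sum => i _; rewrite (le_trans (lip _ _))// ler_pM2l//.
  rewrite (_ : _ - _ - _ = (y' - y) ord0 i); first exact: coord_le_norm.
  by rewrite !mxE; ring.
move=> y; apply/(@cvgrPdist_le _ _ _ (nbhs y) (nbhs_filter y)) => eps eps0.
set I := \int[mu]_z `|q z|.
have I0 : 0 <= I by apply: Rintegral_ge0.
have C0 : 0 < I * (L * d%:R) + 1 by rewrite ltr_wpDl// mulr_ge0// mulr_ge0// ltW.
have ball_y : \forall y' \near y, `|y - y'| <= eps / (I * (L * d%:R) + 1).
  apply/nbhs_ballP; exists (eps / (I * (L * d%:R) + 1)); first exact: divr_gt0.
  by move=> z; rewrite -ball_normE => /ltW.
near=> y'.
have yy' : `|y - y'| <= eps / (I * (L * d%:R) + 1) by near: y'.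
have ik x := @integrable_kern _ _ q iq c x bump_smooth_family bump_bounded_family.
rewrite /mollify -RintegralB//.
have ikB : mu.-integrable setT (EFin \o (fun z => q z * kern c y z - q z * kern c y' z)).
  by rewrite /comp; under eq_fun do rewrite EFinB; apply: integrableB => //; exact: ik.
apply: (le_trans (le_normr_Rintegral _ ikB)) => //.
rewrite (le_trans (y := \int[mu]_z (L * d%:R * `|y' - y| * `|q z|)))//.
  apply: le_Rintegral => //.
  - exact: integrable_norm.
  - rewrite /comp; under eq_fun do rewrite EFinM.
    by apply: integrableZl => //; exact: integrable_norm.
  - by move=> z _; rewrite -mulrBr normrM mulrC ler_wpM2r.
rewrite RintegralZl//; last exact: integrable_norm.
rewrite -/I distrC; move: C0 yy'; set C := I * (L * d%:R) => C0 yy'.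
have C0' : 0 <= C by rewrite mulr_ge0// mulr_ge0// ltW.
rewrite (_ : _ * I = C * `|y - y'|); last by rewrite /C; ring.
rewrite (le_trans (ler_wpM2l C0' yy'))// mulrA ler_pdivrMr//.
by rewrite mulrDr mulr1 [C * eps]mulrC lerDl ltW.
Unshelve. all: by end_near. Qed.

Lemma test_function_kern (O : set 'rV[R]_d) y : [set z | `|z - y| <= e] `<=` O ->
  test_function O (kern c y).
Proof.
move=> yO; split; first exact/smooth_on_kern/bump_smooth_family.
exists [set z | `|z - y| <= e]; split=> //; first exact: compact_cball.
by move=> z /= /negP; rewrite -ltNge => zy; rewrite bump_kern_support// ltW.
Qed.

End bump_kernel.

Lemma near_cball (R : realType) (V : normedModType R) (x : V) (P : V -> Prop) :
  (\forall y \near x, P y) -> exists2 r : R, 0 < r & forall y, `|y - x| <= r -> P y.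
Proof.
move=> /nbhs_ballP[r /= r0 hr]; exists (r / 2); first exact: divr_gt0.
move=> y yx; apply: hr; rewrite -ball_normE/= distrC (le_lt_trans yx)//; lra.
Qed.

(** The point y may leave K, as happens for the kernel balls centred at points of K; hence
    continuity of w in the whole space at the points of K, rather than within K. *)
Lemma unif_continuous_on_compact (R : realType) (V : normedModType R) (K : set V)
    (w : V -> R) (eps : R) : compact K -> (forall x, K x -> {for x, continuous w}) ->
  0 < eps -> exists2 dlt : R, 0 < dlt &
    forall x y, K x -> `|y - x| < dlt -> `|w y - w x| < eps.
Proof.
move=> /compact_near_coveringP cK cw eps0.
have [|dlt /= dlt0 hd] := cK R 0^'+ (fun dlt x => forall y, `|y - x| < dlt -> `|w y - w x| < eps) _.
  move=> x Kx; have e2 : 0 < eps / 2 by rewrite divr_gt0.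
  have /cvgrPdist_lt/(_ _ e2)/nbhs_ballP[r /= r0 hr] := cw x Kx.
  near=> x' dlt => y yx'.
  have x'x : `|x' - x| < r / 2.
    near: x'; apply/nbhs_ballP; exists (r / 2); first exact: divr_gt0.
    by move=> z; rewrite -ball_normE/= distrC.
  have dr : dlt < r / 2 by near: dlt; apply: nbhs_right_lt; exact: divr_gt0.
  have yx : `|y - x| < r.
    rewrite -(subrK x' y) -addrA (le_lt_trans (ler_normD _ _))//.
    by have := lt_trans yx' dr; lra.
  have hy : `|w x - w y| < eps / 2 by apply: hr; rewrite -ball_normE/= distrC.
  have hx : `|w x - w x'| < eps / 2.
    by apply: hr; rewrite -ball_normE/= distrC (lt_le_trans x'x)//; lra.
  rewrite -(subrK (w x) (w y)) -addrA (le_lt_trans (ler_normD _ _))//.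
  by rewrite distrC; lra.
exists (dlt / 2); first exact: divr_gt0.
move=> x y Kx yx; apply: (hd (dlt / 2)) => //=; last by rewrite divr_gt0.
by rewrite sub0r normrN gtr0_norm ?divr_gt0//; lra.
Unshelve. all: by end_near. Qed.

(** * Touching by smooth functions *)

Section derive_coordinates.
Context (R : realType) (d : nat).
Implicit Types (x y a : 'rV[R]_d).

Lemma is_derive_coord i j a y :
  is_derive y (delta_mx ord0 i) (fun y => (y - a) ord0 j) (j == i)%:R.
Proof.
apply/(is_derive_line0 (fun y : 'rV[R]_d => (y - a) ord0 j)).
rewrite (_ : (fun s : R => _) =
    (fun s : R => (j == i)%:R *: s + (y - a) ord0 j)); last first.
  by apply/funext => s; rewrite !mxE eqxx /= /GRing.scale/=; ring.
apply: (is_derive_eq (is_deriveD (is_deriveZ ((j == i)%:R : R) (is_derive_id (0 : R) 1))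
  (is_derive_cst ((y - a) ord0 j) (0 : R) 1))).
by rewrite addr0 [LHS]mulr1.
Qed.

Lemma is_derive_normsq i a y :
  is_derive y (delta_mx ord0 i) (fun y => normsq (y - a)) (2 * (y - a) ord0 i).
Proof.
pose h j (y : 'rV[R]_d) := ((fun y : 'rV[R]_d => (y - a) ord0 j) ^+ 2) y.
have dh j : is_derive y (delta_mx ord0 i) (h j) (2 * (y - a) ord0 j * (j == i)%:R).
  by apply: (is_derive_eq (is_deriveX 2 (is_derive_coord i j a y))); rewrite /GRing.scale/= expr1.
rewrite (_ : (fun y => normsq (y - a)) = \sum_j h j); last first.
  by apply/funext => z; rewrite fct_sumE.
apply: (is_derive_eq (is_derive_sum dh)).
rewrite (bigD1 i)//= eqxx mulr1 big1 ?addr0// => j /negbTE ->.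
by rewrite mulr0.
Qed.

End derive_coordinates.

Section laplacian_at_max.
Context (R : realType) (d : nat).
Local Notation mu := (lebesgue_row R d).
Implicit Types (O : set 'rV[R]_d) (w f psi : 'rV[R]_d -> R) (x y z : 'rV[R]_d).

Lemma integrable_sum_fun (I : Type) (r : seq I) (h : I -> 'rV[R]_d -> R) :
  (forall i, mu.-integrable setT (EFin \o h i)) ->
  mu.-integrable setT (EFin \o (fun z => \sum_(i <- r) h i z)).
Proof.
move=> ih; elim: r => [|i r IHr].
  rewrite (_ : _ \o _ = cst 0%E); first exact: integrable0.
  by apply/funext => z /=; rewrite big_nil.
rewrite (_ : _ \o _ = (fun z => (h i z)%:E + (\sum_(j <- r) h j z)%:E)%E).
  by apply: integrableD => //; exact: ih.
by apply/funext => z /=; rewrite big_cons.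
Qed.

Lemma Rintegral_sum (I : Type) (r : seq I) (h : I -> 'rV[R]_d -> R) :
  (forall i, mu.-integrable setT (EFin \o h i)) ->
  \int[mu]_z (\sum_(i <- r) h i z) = \sum_(i <- r) \int[mu]_z h i z.
Proof.
move=> ih; elim: r => [|i r IHr].
  rewrite big_nil (@eq_Rintegral _ _ _ mu _ (cst 0)); first by rewrite /Rintegral integral0.
  by move=> z _; rewrite big_nil.
rewrite big_cons -IHr -RintegralD//; last exact: integrable_sum_fun.
by apply: eq_Rintegral => z _; rewrite big_cons.
Qed.

(** Adding eta |x - x1|^2 to psi makes the maximum at x1 strict, so the mollified difference still
    has an interior maximum y0 near x1. There the second derivative test bounds the Laplacian of the
    mollified w from above, while the weak equation bounds it from below by almost N f(x1). A gap
    f(x1) > sum H is thus impossible. *)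
Lemma laplacian_at_max O w f psi (h G H : 'I_d -> 'rV[R]_d -> R) x1 :
  open O -> O x1 ->
  mu.-integrable setT (EFin \o w \_ O) ->
  (forall i, mu.-integrable setT (EFin \o h i \_ O)) ->
  (forall i, weak_derivative O [:: i; i] w (h i)) ->
  {ae mu, forall x, O x -> \sum_i h i x = f x} ->
  (forall x, O x -> {for x, continuous w}) -> {for x1, continuous f} ->
  (\forall x \near x1, {for x, continuous psi}) ->
  (\forall x \near x1, forall i, is_derive x (delta_mx ord0 i) psi (G i x) /\
    is_derive x (delta_mx ord0 i) (G i) (H i x)) ->
  {for x1, continuous (fun x => \sum_i H i x)} ->
  (\forall x \near x1, w x - psi x <= w x1 - psi x1) ->
  f x1 <= \sum_i H i x1.
Proof.
move=> oO Ox1 iw ih wh hf cw cf cpsi dpsi cH wmax.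
rewrite leNgt; apply/negP => gap.
(* The perturbation costs 2 d eta, and the oscillations of f and of sum H near x1 cost eta each.
   This makes (2 d + 2) eta, strictly below the gap. *)
pose eta := (f x1 - \sum_i H i x1) / (2 * d%:R + 4).
have d0 : (0 : R) <= d%:R by exact: ler0n.
have eta0 : 0 < eta by rewrite divr_gt0 ?subr_gt0//; lra.
have etaE : f x1 - \sum_i H i x1 = (2 * d%:R + 4) * eta by rewrite /eta; field; lra.
have : \forall x \near x1, [/\ O x, f x1 - eta <= f x,
    \sum_i H i x <= \sum_i H i x1 + eta, w x - psi x <= w x1 - psi x1 &
    {for x, continuous psi} /\ forall i, is_derive x (delta_mx ord0 i) psi (G i x) /\
    is_derive x (delta_mx ord0 i) (G i) (H i x)].
  near=> x; split.
  - by near: x; exact: open_nbhs_nbhs.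
  - rewrite lerBlDr -lerBlDl (le_trans (ler_norm _))//; near: x.
    by move/cvgrPdist_le : cf; exact.
  - rewrite -lerBlDl (le_trans (ler_norm _))// distrC; near: x.
    by move/cvgrPdist_le : cH; exact.
  - by near: x.
  - by split; near: x.
move=> /near_cball[r r0 hr].
pose rho := r / 2.
have rho0 : 0 < rho by rewrite divr_gt0.
have Kr y z : `|y - x1| <= rho -> `|z - y| < rho -> `|z - x1| <= r.
  move=> y1 zy; rewrite -(subrK y z) -addrA (le_trans (ler_normD _ _))//.
  by rewrite /rho in y1 zy *; lra.
(* Mollifying changes w by at most theta at x1 and at y0, so that eta |y0 - x1|^2 <= 2 theta = eta
   rho^2 / 2, which forces y0 into the interior of [K]. *)
pose theta := eta * rho ^+ 2 / 4.
have theta0 : 0 < theta by rewrite divr_gt0// mulr_gt0// exprn_gt0.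
pose K : set 'rV[R]_d := [set y | `|y - x1| <= rho].
have cK : compact K by exact: compact_cball.
have Kx1 : K x1 by rewrite /K/= subrr normr0 ltW.
have KO y : K y -> `|y - x1| <= r.
  by move=> /le_trans; apply; rewrite /rho; lra.
have [dl dl0 wunif] : exists2 dl, 0 < dl &
    forall x y, K x -> `|y - x| < dl -> `|w y - w x| < theta.
  apply: unif_continuous_on_compact => // x /KO/hr[Ox _ _ _ _]; exact: cw.
pose e := Num.min dl rho / 2.
have [e0 edl erho] : [/\ 0 < e, e < dl & e < rho].
  by rewrite /e; case: (leP dl rho) => H1; split; lra.
have [b bb] := bump_exists e0.
have [N N0 kN] := bump_kern_integral d bb.
pose c := fun _ : 'I_d => b.
have sc : smooth_family c := bump_smooth_family bb.
have bc : bounded_family c := bump_bounded_family bb.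
(* Extension by 0 makes w integrable on the whole space; every kernel centred in [K] only sees
   points within r of x1, where q = w. *)
pose q := w \_ O.
have qE z : `|z - x1| <= r -> q z = w z.
  by move=> /hr[Oz _ _ _ _]; rewrite /q patchE mem_set.
pose M y := mollify q c y - N * (psi y + eta * normsq (y - x1)).
have Mcont : {within K, continuous M}.
  apply: continuous_in_subspaceT => y /set_mem Ky.
  have cm : mollify q c z @[z --> y] --> mollify q c y by exact: (continuous_mollify bb).
  have [_ _ _ _ [cp _]] := hr y (KO y Ky).
  have cn : normsq (z - x1) @[z --> y] --> normsq (y - x1).
    apply: (@continuous_comp _ _ _ (fun y => y - x1) (@normsq R d)).
      exact: (cvgB cvg_id (cvg_cst x1)).
    exact: continuous_normsq.
  exact: (cvgB cm (cvgM (cvg_cst N) (cvgD cp (cvgM (cvg_cst eta) cn)))).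
have [y0 /set_mem Ky0 My0] := EVT_max_rV (ex_intro _ x1 Kx1) cK Mcont.
have {}My0 y : K y -> M y <= M y0 by move=> Ky; apply: My0; rewrite inE.
have mollx1 : N * (w x1 - theta) <= mollify q c x1.
  have [ik Nk] := kN x1; apply: (mollify_ge bb) => //; apply: aeW => z zx1.
  rewrite qE; last by rewrite ltW// (lt_trans zx1)// (lt_trans erho)// /rho; lra.
  have := wunif x1 z Kx1 (lt_trans zx1 edl).
  by rewrite ltr_norml => /andP[+ _]; lra.
have molly0 : mollify q c y0 <= N * (w y0 + theta).
  have [ik Nk] := kN y0; apply: (mollify_le bb) => // z zy0.
  rewrite qE; last exact: (Kr y0 z Ky0 (lt_trans zy0 erho)).
  have := wunif y0 z Ky0 (lt_trans zy0 edl).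
  by rewrite ltr_norml => /andP[_ +]; lra.
have y0near : `|y0 - x1| < rho.
  have := My0 x1 Kx1; rewrite /M subrr.
  rewrite normsq0 mulr0 addr0 => h1.
  have [_ _ _ h2 _] := hr y0 (KO y0 Ky0).
  have h3 : N * (eta * normsq (y0 - x1)) <= N * (2 * theta).
    have : N * (w y0 - psi y0) <= N * (w x1 - psi x1) by rewrite ler_pM2l.
    by move: h1 mollx1 molly0; rewrite !mulrDr !mulrN; lra.
  rewrite ler_pM2l// in h3.
  have h4 := norm_le_normsq (y0 - x1).
  have : eta * `|y0 - x1| ^+ 2 <= 2 * theta.
    by rewrite (le_trans _ h3)// ler_pM2l.
  rewrite /theta (_ : 2 * _ = eta * (rho ^+ 2 / 2)); last by field.
  rewrite ler_pM2l// => h5.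
  rewrite ltNge; apply/negP => h6.
  have : rho ^+ 2 <= `|y0 - x1| ^+ 2 by rewrite lerXn2r ?nnegrE// ltW.
  by have := exprn_gt0 2 rho0; lra.
have nearK : \forall y \near y0, K y.
  have : \forall y \near y0, `|y - x1| < rho.
    exact: (cvgr_lt _ (cvg_norm (cvgB cvg_id (cvg_cst x1))) _ y0near).
  by apply: filterS => y; exact: ltW.
have second i : mollify q (derive_at (derive_at c i) i) y0 - N * (H i y0 + 2 * eta) <= 0.
  pose g y := - mollify q (derive_at c i) y - N * (G i y + eta * (2 * (y - x1) ord0 i)).
  apply: (@second_derivative_max _ _ M g y0 (delta_mx ord0 i)).
  - apply: filterS nearK => y Ky.
    have [_ _ _ _ [_ /(_ i)[dp _]]] := hr y (KO y Ky).
    exact: is_deriveB (@is_derive_mollify _ _ q iw c i y sc bc) (is_deriveZ N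
      (is_deriveD dp (is_deriveZ eta (is_derive_normsq i x1 y)))).
  - have [_ _ _ _ [_ /(_ i)[_ dp]]] := hr y0 (KO y0 Ky0).
    have dm := is_deriveN (@is_derive_mollify _ _ q iw _ i y0 (@smooth_family_derive_at _ _ c i sc)
      (@bounded_family_derive_at _ _ c i bc)).
    have dc := is_derive_coord i i x1 y0.
    apply: (is_derive_eq (is_deriveB dm (is_deriveZ N
      (is_deriveD dp (is_deriveZ eta (is_deriveZ 2 dc)))))).
    by rewrite /GRing.scale/= opprK eqxx mulr1n; ring.
  - by apply: filterS nearK => y Ky; exact: My0.
have [ik0 Nk0] := kN y0.
(* The kernel centred at y0 is a test function, so its two derivatives pass to w; the sum of the
   weak derivatives is f almost everywhere, and f >= f x1 - eta on the support. *)
have sum2 : N * (f x1 - eta) <= \sum_i mollify q (derive_at (derive_at c i) i) y0.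
  have tk : test_function O (kern c y0).
    apply: (test_function_kern bb e0) => z /= zy0.
    by have [] := hr z (Kr y0 z Ky0 (le_lt_trans zy0 erho)).
  have E i : mollify q (derive_at (derive_at c i) i) y0 =
      \int[mu]_z ((h i \_ O) z * kern c y0 z).
    have := wh i _ tk; rewrite [LHS]Rintegral_mkcond [X in _ * X]Rintegral_mkcond.
    rewrite /= sqrrN expr1n mul1r => Ei.
    rewrite [RHS](@eq_Rintegral _ _ _ mu _ ((fun x => h i x * kern c y0 x) \_ O)); last first.
      by move=> z _; rewrite !patchE; case: ifPn => // _; rewrite mul0r.
    rewrite -Ei /mollify; apply: eq_Rintegral => z _.
    rewrite /q !patchE; case: ifPn => _; last by rewrite mul0r.
    by rewrite partial_kern// partial_kern//; exact: smooth_family_derive_at.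
  rewrite (eq_bigr _ (fun i _ => E i)) -Rintegral_sum; last first.
    by move=> i; exact: integrable_kern.
  rewrite (@eq_Rintegral _ _ _ mu _ (fun z => (\sum_i (h i \_ O) z) * kern c y0 z)); last first.
    by move=> z _; rewrite mulr_suml.
  apply: (mollify_ge bb) => //; first exact: integrable_sum_fun.
  apply: filterS hf => z hz zy0.
  have [Oz fz _ _ _] := hr z (Kr y0 z Ky0 (lt_trans zy0 erho)).
  rewrite (eq_bigr (fun i => h i z)) ?hz// => i _.
  by rewrite patchE mem_set.
have sum1 : \sum_i mollify q (derive_at (derive_at c i) i) y0 <= N * (\sum_i H i y0 + 2 * d%:R * eta).
  rewrite (_ : N * _ = \sum_(i < d) (N * (H i y0 + 2 * eta))).
    by apply: ler_sum => i _; rewrite -subr_le0.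
  rewrite -mulr_sumr big_split/= sumr_const card_ord -mulr_natl; congr (N * (_ + _)).
  by ring.
have [_ _ Hy0 _ _] := hr y0 (KO y0 Ky0).
have := le_trans sum2 sum1; rewrite ler_pM2l//.
by move: etaE Hy0; rewrite mulrDl; nra.
Unshelve. all: by end_near. Qed.

End laplacian_at_max.

Section first_derivative_test.
Context (R : realType) (V : normedModType R).

Lemma first_derivative_min (m g : V -> R) (x v : V) :
  (\forall y \near x, is_derive y v m (g y)) ->
  (\forall y \near x, m x <= m y) -> g x = 0.
Proof.
move=> dm mx.
pose L t := t *: v + x.
have cL : L t @[t --> (0 : R)] --> x.
  rewrite -[X in _ --> X](_ : 0 *: v + x = x); last by rewrite scale0r add0r.
  by apply: cvgD; [apply: cvgZ; [exact: cvg_id|exact: cvg_cst]|exact: cvg_cst].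
have : \forall t \near (0 : R), is_derive (L t) v m (g (L t)) /\ m x <= m (L t).
  near=> t; split; near: t; [exact: (cL _ dm)|exact: (cL _ mx)].
move=> /near_cball[e e0 he].
have L0 : L 0 = x by rewrite /L scale0r add0r.
have {}he (t : R) : t \in `](- e), e[ ->
    is_derive t 1 (fun s => m (L s)) (g (L t)) /\ m x <= m (L t).
  rewrite in_itv/= -ltr_norml => te.
  have [|h1 h2] := he t; first by rewrite subr0 ltW.
  by split=> //; apply/is_derive_line.
have e0' : (0 : R) \in `](- e), e[ by rewrite in_itv/= oppr_lt0 e0.
have d0 : is_derive (0 : R) 1 (fun s => m (L s)) 0.
  apply: (@derive1_at_min R (fun s => m (L s)) (- e) e 0) => //; first by lra.
  - by move=> t /he[[]].
  - by move=> t /he[_]; rewrite L0.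
have [h _] := he 0 e0'.
by rewrite -L0 -(derive1_val h) (derive1_val d0).
Unshelve. all: by end_near. Qed.

End first_derivative_test.

Lemma is_derive_pow (R : realType) (V : normedModType R) (f : V -> R) k (x v : V) df :
  is_derive x v f df ->
  is_derive x v (fun y => f y ^+ k.+1) (k.+1%:R * f x ^+ k * df).
Proof.
move=> fdf; rewrite (_ : (fun _ => _) = f ^+ k.+1); first exact: is_deriveX.
by apply/funext => y; rewrite fctE.
Qed.

(** * Hopf lemma and strong maximum principle *)

Section maximum_principle.
Context (R : realType) (d : nat).
Implicit Types (O : set 'rV[R]_d) (z H : 'rV[R]_d -> R) (x y a : 'rV[R]_d).

(** Derivatives are carried as data, so that sums and multiples of test functions come with explicit
    gradients and Laplacians. Only pure second derivatives occur, and only their sum has to be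
    continuous. *)
Definition C2_at x H (G L : 'I_d -> 'rV[R]_d -> R) :=
  [/\ \forall y \near x, {for y, continuous H},
      \forall y \near x, forall i, is_derive y (delta_mx ord0 i) H (G i y) /\
        is_derive y (delta_mx ord0 i) (G i) (L i y)
    & {for x, continuous (fun y => \sum_i L i y)}].

(* In the viscosity sense: [H] touches [z] from below at [x]. *)
Definition supersolution O (B C : R) z := forall x H G L, O x -> C2_at x H G L ->
  (\forall y \near x, z x - H x <= z y - H y) ->
  \sum_i L i x <= B * \sum_i `|G i x| + C * `|z x|.

Section barrier.
Variables (y : 'rV[R]_d) (Q eps : R) (n : nat).
Let P x := 2 * Q - normsq (x - y).

(* The polynomial in s = |x - y|^2 vanishes on the sphere s = Q; a large exponent
   plays the role of a large alpha in the usual barrier e^(-alpha s). *)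
Definition barrier x := eps * ((2 * Q - normsq (x - y)) ^+ n.+2 - Q ^+ n.+2).

Definition barrier_grad i x :=
  - eps * (2 * n.+2%:R) * (P x ^+ n.+1 * (x - y) ord0 i).

Definition barrier_hess i x := eps * (2 * n.+2%:R) *
  (2 * n.+1%:R * P x ^+ n * ((x - y) ord0 i) ^+ 2 - P x ^+ n.+1).

Lemma barrier_lap x : \sum_i barrier_hess i x = eps * (2 * n.+2%:R) *
  (2 * n.+1%:R * P x ^+ n * normsq (x - y) - d%:R * P x ^+ n.+1).
Proof.
rewrite /barrier_hess -mulr_sumr; congr (_ * _).
rewrite sumrB sumr_const card_ord; congr (_ - _); last by rewrite mulr_natl.
by rewrite -mulr_sumr.
Qed.

Lemma continuous_normsq_sub : continuous (fun x => normsq (x - y)).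
Proof.
move=> x; apply: (@continuous_comp _ _ _ (fun x => x - y) (@normsq R d)).
  exact: (cvgB cvg_id (cvg_cst y)).
exact: continuous_normsq.
Qed.

Lemma continuous_barrier_base k x : P x' ^+ k @[x' --> x] --> P x ^+ k.
Proof.
have cN : normsq (x' - y) @[x' --> x] --> normsq (x - y).
  exact: continuous_normsq_sub.
have cP : P x' @[x' --> x] --> P x by exact: (cvgB (cvg_cst (2 * Q)) cN).
apply: (@continuous_comp _ _ _ P (fun t => t ^+ k)); first exact: cP.
exact: exprn_continuous.
Qed.

Lemma C2_barrier x : C2_at x barrier barrier_grad barrier_hess.
Proof.
have dP i x' : is_derive x' (delta_mx ord0 i) P (- (2 * (x' - y) ord0 i)).
  apply: (is_derive_eq (is_deriveB (is_derive_cst (2 * Q) x' _) (is_derive_normsq i y x'))).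
  by rewrite sub0r.
have cP := continuous_barrier_base.
split.
- apply: (@nearW _ (nbhs x) _ (nbhs_filter x)) => x'.
  have : barrier x'' @[x'' --> x'] --> barrier x' by
    exact: (cvgM (cvg_cst eps) (cvgB (cP n.+2 x') (cvg_cst (Q ^+ n.+2)))).
  exact.
- apply: (@nearW _ (nbhs x) _ (nbhs_filter x)) => x' i; split.
    apply: (is_derive_eq (is_deriveZ eps
      (is_deriveB (is_derive_pow n.+1 (dP i x')) (is_derive_cst (Q ^+ n.+2) x' _)))).
    by rewrite /barrier_grad /GRing.scale/=; ring.
  apply: (is_derive_eq (is_deriveZ (- eps * (2 * n.+2%:R))
    (is_deriveM (is_derive_pow n (dP i x')) (is_derive_coord i i y x')))).
  by rewrite /barrier_hess /GRing.scale/= eqxx mulr1n; ring.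
- rewrite (_ : (fun _ => _) = (fun x => eps * (2 * n.+2%:R) *
    (2 * n.+1%:R * P x ^+ n * normsq (x - y) - d%:R * P x ^+ n.+1))).
    have cN : normsq (x' - y) @[x' --> x] --> normsq (x - y).
      exact: continuous_normsq_sub.
    have := cvgM (cvg_cst (eps * (2 * n.+2%:R)))
      (cvgB (cvgM (cvgM (cvg_cst (2 * n.+1%:R : R)) (cP n x)) cN)
            (cvgM (cvg_cst (d%:R : R)) (cP n.+1 x))).
    exact.
  by apply/funext => x'; rewrite barrier_lap.
Qed.

End barrier.

Lemma normsqZ (t : R) x : normsq (t *: x) = t ^+ 2 * normsq x.
Proof. by rewrite /normsq mulr_sumr; apply: eq_bigr => i _; rewrite mxE exprMn. Qed.

Lemma normsq_eq0 x : (normsq x == 0) = (x == 0).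
Proof.
apply/idP/idP => [/eqP x0|/eqP ->]; last by rewrite normsq0.
by have := norm_le_normsq x; rewrite x0 -normr_eq0 -sqrf_eq0 eq_le sqr_ge0 => ->.
Qed.

(** From (|x| - 1)^2 >= 0. This bound without square roots is the source of the factors 1 + Q in the
    Hopf lemma. *)
Lemma coord_le_normsq x i : `|x ord0 i| <= 1 + normsq x.
Proof.
have := coord_le_norm x i; have := norm_le_normsq x.
have : 0 <= (`|x| - 1) ^+ 2 by exact: sqr_ge0.
by have := normr_ge0 x; nra.
Qed.

Lemma compact_normsq_ball y Q : compact [set x | normsq (x - y) <= Q].
Proof.
apply: (@subclosed_compact _ _ [set x : 'rV[R]_d | `|x - y| <= 1 + `|Q|]).
  have cN : continuous (fun x => normsq (x - y)) by exact: continuous_normsq_sub.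
  by move/continuous_closedP : cN => /(_ _ (@closed_le _ Q)).
  exact: compact_cball.
move=> x /= xQ; apply/row_norm_leP; first by rewrite addr_ge0.
move=> i; rewrite (le_trans (coord_le_normsq _ _))// lerD2l (le_trans xQ)//.
exact: ler_norm.
Qed.

Lemma near_normsq_lt y Q x : normsq (x - y) < Q ->
  \forall x' \near x, normsq (x' - y) < Q.
Proof.
move=> xQ; have cN : normsq (x' - y) @[x' --> x] --> normsq (x - y).
  exact: continuous_normsq_sub.
exact: (cvgr_lt _ cN _ xQ).
Qed.

(** Moving x towards y by a fraction t multiplies the squared distance to y by (1 - t)^2, which
    enters the open ball. *)
Lemma closed_normsq_ball_closure O y Q : 0 < Q ->
  (forall x, normsq (x - y) < Q -> O x) ->
  forall x, normsq (x - y) <= Q -> closure O x.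
Proof.
move=> Q0 yO x xQ A /nbhs_ballP[e /= e0 eA].
have [t [t0 t1 tx]] : exists t : R, [/\ 0 < t, t <= 1 & t * `|y - x| < e].
  have N0 : 0 < 1 + `|y - x| by rewrite ltr_wpDr.
  exists (Num.min 1 (e / (1 + `|y - x|))); split.
  - by rewrite lt_min ltr01 divr_gt0.
  - by rewrite ge_min lexx.
  - have tle : Num.min 1 (e / (1 + `|y - x|)) <= e / (1 + `|y - x|).
      by rewrite ge_min lexx orbT.
    rewrite (le_lt_trans (ler_wpM2r _ tle))// mulrAC ltr_pdivrMr//.
    by rewrite ltr_pM2l// ltrDr.
exists (x + t *: (y - x)); split.
  apply: yO; rewrite (_ : _ - y = (1 - t) *: (x - y)).
    have t1' : 0 <= 1 - t by lra.
    rewrite normsqZ (le_lt_trans (ler_wpM2l (sqr_ge0 _) xQ))//.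
    by have := mulr_gt0 t0 Q0; nra.
  by apply/rowP => i; rewrite !mxE; ring.
apply: eA; rewrite -ball_normE/= opprD addNKr normrN normrZ gtr0_norm//.
Qed.

(** Linear growth along the radius from xs, a form that serves at interior zeros as well as on the
    boundary. The barrier H stays below z in the closed ball: H = 0 <= z on the sphere and H <= m0
    <= z in the core s <= Q / 4, so a negative minimum of z - H lies in between, where H touches z
    from below and has too large a Laplacian. *)
Lemma hopf O B C z y Q xs : open O -> supersolution O B C z -> 0 <= B -> 0 <= C ->
  0 < Q -> {within closure O, continuous z} -> (forall x, closure O x -> 0 <= z x) ->
  (forall x, normsq (x - y) < Q -> O x /\ 0 < z x) -> normsq (xs - y) = Q ->
  exists2 eps : R, 0 < eps &
    forall t, 0 <= t <= 1 -> eps * t <= z (xs + t *: (y - xs)).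
Proof.
move=> oO ssz B0 C0 Q0 cz z0 zball xsQ.
have DO x : normsq (x - y) <= Q -> closure O x.
  by apply: closed_normsq_ball_closure => // x' /zball[].
have yQ4 : normsq (y - y) <= Q / 4.
  by rewrite subrr normsq0 divr_ge0// ltW.
have [m0 m00 zm0] : exists2 m0, 0 < m0 & forall x, normsq (x - y) <= Q / 4 -> m0 <= z x.
  have cin : {within [set x | normsq (x - y) <= Q / 4], continuous z}.
    by apply: continuous_subspaceW cz => x /= xQ; apply: DO; lra.
  have [x1 /set_mem/= x1Q zmin] :=
    EVT_min_rV (ex_intro _ y yQ4) (compact_normsq_ball (y := y) (Q := Q / 4)) cin.
  exists (z x1); first by have [|] := zball x1 => //; lra.
  by move=> x xQ; apply: zmin; rewrite inE.
have d0 : (0 : R) <= d%:R by exact: ler0n.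
(* Between core and sphere s > Q / 4 and p <= 2 Q, so the leading term 2 (n + 1) s is at least (n +
   1) Q / 2. The part A Q / 2 of it absorbs d p and the first-order term and leaves 2 C Q^2 for the
   zero-order term; the remaining Q / 2 makes the contradiction strict. *)
set A := 4 * d%:R + 4 * B * d%:R * (1 + Q) + 4 * C * Q.
have [n nA] : exists n, A < n%:R.
  exists (Num.bound A); apply: archi_boundP.
  by rewrite /A !addr_ge0 ?mulr_ge0 ?addr_ge0// ltW.
have n0 : (0 : R) <= n%:R by exact: ler0n.
have Qn0 : 0 < (2 * Q) ^+ n.+2 by rewrite exprn_gt0// mulr_gt0.
(* With this eps the barrier never exceeds m0, hence lies below z in the core. *)
have [eps eps0 m0E] : exists2 eps, 0 < eps & m0 = eps * (2 * Q) ^+ n.+2.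
  by exists (m0 / (2 * Q) ^+ n.+2); rewrite ?divr_gt0// divfK// gt_eqF.
pose H := barrier y Q eps n.
have cH : continuous H.
  move=> x; have [/nbhs_singleton] := C2_barrier y Q eps n x; exact.
have cont : {within [set x | normsq (x - y) <= Q], continuous (fun x => z x - H x)}.
  have cD : {within [set x | normsq (x - y) <= Q], continuous z}.
    exact: continuous_subspaceW DO cz.
  have cHD : {within [set x | normsq (x - y) <= Q], continuous H}.
    exact: continuous_subspaceT.
  by move=> x; exact: (cvgB (cD x) (cHD x)).
have xsD : [set x | normsq (x - y) <= Q] xs by rewrite /= xsQ.
have [x1 /set_mem/= x1Q zmin] :=
  EVT_min_rV (ex_intro _ xs xsD) (compact_normsq_ball (y := y) (Q := Q)) cont.
have {}zmin x : normsq (x - y) <= Q -> z x1 - H x1 <= z x - H x.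
  by move=> xQ; apply: zmin; rewrite inE.
have zH x : normsq (x - y) <= Q -> H x <= z x.
  move=> xQ; rewrite -subr_ge0 (le_trans _ (zmin x xQ))// subr_ge0 leNgt.
  apply/negP => neg.
  have x1lt : normsq (x1 - y) < Q.
    rewrite lt_neqAle x1Q andbT; apply/negP => /eqP x1E.
    move: neg; rewrite /H /barrier x1E (_ : 2 * Q - Q = Q); last by ring.
    by rewrite subrr mulr0 ltNge z0//; exact: DO.
  have x1gt : Q / 4 < normsq (x1 - y).
    rewrite ltNge; apply/negP => /zm0 m0z.
    move: neg; rewrite ltNge (le_trans _ m0z)//.
    have s0 := normsq_ge0 (x1 - y).
    rewrite m0E /H /barrier ler_pM2l// lerBlDr.
    have : (2 * Q - normsq (x1 - y)) ^+ n.+2 <= (2 * Q) ^+ n.+2.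
      by rewrite lerXn2r ?nnegrE//; lra.
    by have := exprn_ge0 n.+2 (ltW Q0); lra.
  have [Ox1 zx1] := zball x1 x1lt.
  have := ssz x1 _ _ _ Ox1 (C2_barrier y Q eps n x1).
  have locmin : \forall x' \near x1, z x1 - barrier y Q eps n x1 <= z x' - barrier y Q eps n x'.
    by apply: filterS (near_normsq_lt x1lt) => x' /ltW; exact: zmin.
  move/(_ locmin); rewrite barrier_lap.
  set s := normsq (x1 - y) in x1lt x1gt *; set p := 2 * Q - s.
  have p0 : 0 < p by rewrite /p; lra.
  have pn0 : 0 < p ^+ n by rewrite exprn_gt0.
  (* Since z < H at x1, the barrier itself bounds the zero-order term, and eps p^n becomes a common
     factor of the whole inequality. *)
  have zle : z x1 <= eps * (p ^+ n * p ^+ 2).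
    rewrite (le_trans (ltW neg))// /H /barrier -/s -/p ler_pM2l// -exprD addn2.
    by rewrite lerBlDr lerDl exprn_ge0// ltW.
  have Gle : \sum_i `|barrier_grad y Q eps n i x1| <=
      eps * (2 * n.+2%:R) * (p ^+ n * p * (d%:R * (1 + Q))).
    have -> : eps * (2 * n.+2%:R) * (p ^+ n * p * (d%:R * (1 + Q))) =
        \sum_(i < d) eps * (2 * n.+2%:R) * (p ^+ n * p * (1 + Q)).
      by rewrite sumr_const card_ord -[RHS]mulr_natl; ring.
    apply: ler_sum => i _; rewrite /barrier_grad !mulNr normrN -/s -/p exprSr.
    rewrite !normrM (gtr0_norm eps0) (gtr0_norm pn0) (gtr0_norm p0) !normr_nat.
    rewrite ler_wpM2l ?mulr_ge0 ?(ltW eps0)//.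
    rewrite ler_wpM2l ?mulr_ge0 ?(ltW pn0) ?(ltW p0)//.
    by rewrite (le_trans (coord_le_normsq _ _))// lerD2l ltW.
  rewrite (ger0_norm (ltW zx1)) exprSr => main.
  have : eps * (2 * n.+2%:R) * (2 * n.+1%:R * p ^+ n * s - d%:R * (p ^+ n * p)) <=
      B * (eps * (2 * n.+2%:R) * (p ^+ n * p * (d%:R * (1 + Q)))) +
      C * (eps * (p ^+ n * p ^+ 2)).
    by rewrite (le_trans main)// lerD// ler_wpM2l.
  have -> : eps * (2 * n.+2%:R) * (2 * n.+1%:R * p ^+ n * s - d%:R * (p ^+ n * p)) =
    (eps * p ^+ n) * ((2 * n.+2%:R) * (2 * n.+1%:R * s - d%:R * p)) by ring.
  have -> : B * (eps * (2 * n.+2%:R) * (p ^+ n * p * (d%:R * (1 + Q)))) +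
      C * (eps * (p ^+ n * p ^+ 2)) =
    (eps * p ^+ n) * ((2 * n.+2%:R) * (B * (p * (d%:R * (1 + Q)))) + C * p ^+ 2) by ring.
  rewrite ler_pM2l ?mulr_gt0// => {}main.
  have s0 : 0 <= s by exact: normsq_ge0.
  have p2Q : p <= 2 * Q by rewrite /p; lra.
  have n1 : n.+1%:R = n%:R + 1 :> R by rewrite natr1.
  have n2 : n.+2%:R = n%:R + 2 :> R by rewrite -natr1 n1; ring.
  have h1 : (n%:R + 1) * (Q / 4) <= (n%:R + 1) * s by rewrite ler_wpM2l ?ltW//; lra.
  have h2 : d%:R * p <= d%:R * (2 * Q) by rewrite ler_wpM2l.
  have h3 : B * (p * (d%:R * (1 + Q))) <= B * (2 * Q * (d%:R * (1 + Q))).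
    by rewrite ler_wpM2l// ler_wpM2r// mulr_ge0// addr_ge0// ltW.
  have h4 : C * p ^+ 2 <= C * (2 * Q) ^+ 2.
    by rewrite ler_wpM2l// lerXn2r ?nnegrE ?(ltW p0) ?mulr_ge0 ?(ltW Q0).
  have h5 : A * Q <= n%:R * Q by rewrite ler_pM2r// ltW.
  have h6 : A * Q = 4 * (d%:R * Q) + 4 * (B * (Q * (d%:R * (1 + Q)))) + 4 * (C * Q ^+ 2).
    by rewrite /A; ring.
  have X0 : 2 * (C * Q ^+ 2) + Q / 2 <=
      2 * n.+1%:R * s - d%:R * p - B * (p * (d%:R * (1 + Q))).
    by rewrite n1; lra.
  have CQ0 : 0 <= C * Q ^+ 2 by rewrite mulr_ge0// sqr_ge0.
  have : (2 * n.+2%:R) * (2 * (C * Q ^+ 2) + Q / 2) <= 4 * (C * Q ^+ 2).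
    have k0 : 0 <= 2 * n.+2%:R :> R by rewrite mulr_ge0.
    rewrite (le_trans (ler_wpM2l k0 X0))//.
    by move: main h4; rewrite exprMn; lra.
  by rewrite n2; nra.
pose q := Q ^+ n.+2.
have q0 : 0 < q by rewrite exprn_gt0.
exists (eps * q); first by rewrite mulr_gt0.
move=> t /andP[t0 t1].
have tE : normsq (xs + t *: (y - xs) - y) = (1 - t) ^+ 2 * Q.
  rewrite (_ : _ - y = (1 - t) *: (xs - y)) ?normsqZ ?xsQ//.
  by apply/rowP => i; rewrite !mxE; ring.
have t1' : (1 - t) ^+ 2 <= 1 by nra.
(* With a = 2 - (1 - t)^2 the barrier on the segment equals eps q (a^(n+2) - 1), and a^(n+2) >= a >=
   1 + t. *)
apply: (le_trans _ (zH _ _)); last by rewrite tE ler_piMl// ltW.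
rewrite /H /barrier tE (_ : 2 * Q - _ = (2 - (1 - t) ^+ 2) * Q); last by ring.
rewrite exprMn -/q -[X in _ - X]mul1r -mulrBl -mulrA ler_pM2l// mulrC ler_pM2r//.
set a := 2 - _.
have a1 : 1 + t <= a by rewrite /a; nra.
have : a <= a ^+ n.+2 by rewrite exprS ler_peMr// ?exprn_ege1//; lra.
by lra.
Qed.

End maximum_principle.

Section strong_maximum_principle.
Context (R : realType) (d : nat).
Implicit Types (O : set 'rV[R]_d) (z : 'rV[R]_d -> R) (x y a : 'rV[R]_d).

(** The zero set is closed in O by continuity. It is open too: were z x > 0 for some x close to a
    zero, the Hopf lemma in the ball centred at x that reaches the nearest zero p would give z
    linear growth at p, whereas the derivative of z at its interior minimum p is 0. *)
Lemma strong_maximum O B C z : open O -> connected O ->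
  supersolution O B C z -> 0 <= B -> 0 <= C ->
  {within closure O, continuous z} -> (forall x, O x -> differentiable z x) ->
  (forall x, closure O x -> 0 <= z x) ->
  (exists2 a, O a & z a = 0) -> forall x, O x -> z x = 0.
Proof.
move=> oO cO ssz B0 C0 cz dz z0 [a0 Oa0 za0].
pose Z := [set x | O x /\ z x = 0].
have Ocl x : O x -> closure O x by exact: subset_closure.
have czO x : O x -> {for x, continuous z}.
  by move=> Ox; exact/differentiable_continuous/dz.
have Zcl x : O x -> closure Z x -> z x = 0.
  move=> Ox Zx; apply/eqP; rewrite eq_le z0 ?andbT; last exact: Ocl.
  rewrite leNgt; apply/negP => zx.
  have [x' [[_ zx'0]]] := Zx _ (cvgr_gt _ (czO x Ox) _ zx).
  by rewrite /= zx'0 ltxx.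
suff ZE : Z = O by move=> x; rewrite -ZE => -[].
apply: cO; first by exists a0.
- exists Z°; first exact: open_interior.
  apply/seteqP; split=> [a Za|a [Oa /interior_subset Za]]; last by [].
  split; first by case: Za.
  have [Oa za] := Za.
  have : \forall x \near a, O x by apply: open_nbhs_nbhs.
  move=> /near_cball[e e0 eO].
  have := near_normsq_lt (y := a) (Q := (e / 2) ^+ 2) (x := a).
  rewrite subrr normsq0 exprn_gt0 ?divr_gt0// => /(_ isT).
  apply: filterS => x xa.
  have e20 : 0 <= e / 2 by rewrite divr_ge0// ltW.
  have norm_lt (p q : 'rV[R]_d) : normsq (p - q) < (e / 2) ^+ 2 -> `|p - q| <= e / 2.
    move=> pq; rewrite -(ler_pXn2r (n := 2))// ?nnegrE//.
    by rewrite (le_trans (norm_le_normsq _))// ltW.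
  have xa' : normsq (a - x) < (e / 2) ^+ 2.
    by rewrite -opprB -scaleN1r normsqZ sqrrN expr1n mul1r.
  have ballO p : normsq (p - x) <= normsq (a - x) -> O p.
    move=> px; apply: eO; rewrite -(subrK x p) -addrA (le_trans (ler_normD _ _))//.
    by have := norm_lt _ _ xa; have := norm_lt _ _ (le_lt_trans px xa'); lra.
  have Ox : O x.
    by apply: ballO; rewrite subrr normsq0 normsq_ge0.
  split=> //; apply/eqP/negPn/negP => zx.
  (* Cutting with the ball through a makes the search for a nearest zero a compact problem; as x is
     within e / 2 of a, this ball lies in O, where closure points of [Z] are zeros. *)
  pose T := [set p | normsq (p - x) <= normsq (a - x)] `&` closure Z.
  have Ta : T a by split=> //=; exact: subset_closure.
  have cT : compact T.
    by apply: compact_closedI; [exact: compact_normsq_ball|exact: closed_closure].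
  have cN : {within T, continuous (fun p => normsq (p - x))}.
    exact/continuous_subspaceT/continuous_normsq_sub.
  have [p /set_mem[/= px pZ] pmin] := EVT_min_rV (ex_intro _ a Ta) cT cN.
  have Op := ballO p px.
  have zp := Zcl p Op pZ.
  pose Q := normsq (p - x).
  have Q0 : 0 < Q.
    rewrite lt_neqAle normsq_ge0 andbT eq_sym normsq_eq0 subr_eq0.
    by apply: contra_neq zx => <-.
  have zball q : normsq (q - x) < Q -> O q /\ 0 < z q.
    move=> qQ; have Oq : O q by apply: ballO; rewrite ltW// (lt_le_trans qQ).
    split=> //; rewrite lt_neqAle z0 ?andbT; last exact: Ocl.
    apply/negP => /eqP zq; have : T q.
      split; first by rewrite /= ltW// (lt_le_trans qQ).
      by apply: subset_closure.
    by move=> /mem_set/pmin; rewrite leNgt qQ.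
  have [eps eps0 zeps] := hopf oO ssz B0 C0 Q0 cz z0 zball (erefl Q).
  have nearO : \forall q \near p, O q by apply: open_nbhs_nbhs.
  have dzp : 'D_(x - p) z p = 0.
    apply: (@first_derivative_min _ _ z (fun q => 'D_(x - p) z q) p (x - p)).
      apply: filterS nearO => q Oq.
      by apply/derivableP/diff_derivable/dz.
    by apply: filterS nearO => q Oq; rewrite zp z0//; exact: Ocl.
  have : is_derive p (x - p) z 0.
    by rewrite -dzp; apply/derivableP/diff_derivable/dz.
  move=> [/cvg_ex[l cl]]; rewrite /derive (cvg_lim _ cl)// => l0.
  move: cl; rewrite l0 => /cvgr0Pnorm_lt/(_ _ eps0)[t /= t0 ht].
  pose s := Num.min 1 t / 2.
  have s0 : 0 < s by rewrite divr_gt0// lt_min ltr01.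
  have [s1 st] : s <= 1 /\ s < t.
    by rewrite /s; case: (leP 1 t) => H1; split; lra.
  have := ht s; rewrite /= sub0r normrN gtr0_norm// => /(_ st (lt0r_neq0 s0)).
  rewrite zp subr0 normrZ normfV gtr0_norm// ltr_pdivrMl// addrC ltNge => /negP; apply.
  by rewrite (le_trans _ (ler_norm _))// mulrC zeps// (ltW s0).
- exists (closure Z); first exact: closed_closure.
  apply/seteqP; split=> [x Zx|x [Ox Zx]].
    by split; [case: Zx|exact: subset_closure].
  by split=> //; exact: Zcl.
Qed.

End strong_maximum_principle.

Lemma differentiable_lipschitz_at (R : realType) (V W : normedModType R) (f : V -> W) x :
  differentiable f x ->
  exists2 M : R, 0 < M & \forall y \near x, `|f y - f x| <= M * `|y - x|.
Proof.
move=> df; have [cd /eqaddoP ho] := (diff_locallyP _ _).1 df.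
have [k k0 dk] := linear_lipschitz cd.
exists (k + 1); first by rewrite addr_gt0.
have /near_cball[e e0 he] := ho 1 ltr01.
apply/nbhs_ballP; exists e => // y; rewrite -ball_normE/= distrC => yx.
have := he (y - x); rewrite subr0 => /(_ (ltW yx)); rewrite mul1r !fctE /= subrK => h.
rewrite mulrDl mul1r -(subrK ('d f x (y - x)) (f y - f x)) addrC.
rewrite (le_trans (ler_normD _ _))// lerD//.
by move: h; rewrite opprD addrA.
Qed.

(** * Boundary minima *)

Section interior_ball.
Context (R : realType) (d : nat).
Implicit Types (O : set 'rV[R]_d) (f z : 'rV[R]_d -> R) (x y a delta : 'rV[R]_d).

Lemma is_derive_row f x delta : differentiable f x ->
  is_derive x delta f (\sum_i delta ord0 i * partial i f x).
Proof.
move=> df; apply: DeriveDef; first exact: diff_derivable.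
rewrite deriveE// {1}[delta]row_sum_delta linear_sum; apply: eq_bigr => i _.
by rewrite linearZ/= /partial deriveE.
Qed.

(** An upper Taylor bound by the mean value theorem on the segment from x to y, using only that the
    first derivatives satisfy a Lipschitz estimate at x. *)
Lemma second_order_bound f x : (\forall y \near x, differentiable f y) ->
  (forall i, differentiable (partial i f) x) ->
  exists2 M : R, 0 < M & \forall y \near x,
    f y <= f x + \sum_i (y - x) ord0 i * partial i f x + M * normsq (y - x).
Proof.
move=> df dpf.
have /choice[M hM] : forall i, exists M : R, 0 < M /\
    \forall y \near x, `|partial i f y - partial i f x| <= M * `|y - x|.
  by move=> i; have [M M0 h] := differentiable_lipschitz_at (dpf i); exists M.
have M0 i : 0 < M i by have [] := hM i.
(* The summand 1 keeps the constant positive when d = 0. *)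
exists (1 + \sum_i M i); first by rewrite ltr_pwDl// sumr_ge0// => i _; exact: ltW.
have : \forall y \near x, differentiable f y /\
    forall i, `|partial i f y - partial i f x| <= M i * `|y - x|.
  near=> y; split; first by near: y.
  by near: y; apply: filter_forall => i; have [] := hM i.
move=> /near_cball[e e0 he].
apply/nbhs_ballP; exists e => // y; rewrite -ball_normE/= distrC => yx.
pose delta := y - x.
have L1 (t : R) : 0 <= t <= 1 -> `|t *: delta + x - x| <= e.
  move=> /andP[t0 t1]; rewrite addrK normrZ ger0_norm//.
  by rewrite (le_trans _ (ltW yx))// ler_piMl.
have dL (t : R) : 0 <= t <= 1 -> is_derive t 1 (fun s : R => f (s *: delta + x))
    (\sum_i delta ord0 i * partial i f (t *: delta + x)).
  by move=> t01; apply/is_derive_line/is_derive_row; have [] := he _ (L1 t t01).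
have [||s] := @MVT R (fun s => f (s *: delta + x))
    (fun t => \sum_i delta ord0 i * partial i f (t *: delta + x)) 0 1 ltr01.
- by move=> t; rewrite in_itv/= => /andP[t0 t1]; apply: dL; rewrite !ltW.
- apply: derivable_within_continuous => t; rewrite in_itv/= => t01.
  by have [] := dL t t01.
rewrite in_itv/= => /andP[s0 s1].
rewrite scale1r scale0r add0r subr0 mulr1 /delta subrK => fE.
rewrite -/delta -addrA -lerBlDl fE -lerBlDl -sumrB.
rewrite mulrDl mul1r mulr_suml (le_trans (y := \sum_i M i * normsq delta))//.
  apply: ler_sum => i _; rewrite -mulrBr (le_trans (ler_norm _))// normrM.
  have s01 : 0 <= s <= 1 by rewrite !ltW.
  have [_ /(_ i) h] := he _ (L1 s s01).
  rewrite (le_trans (ler_pM _ _ (coord_le_norm _ i) h))//.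
  rewrite mulrCA ler_pM2l// (le_trans _ (norm_le_normsq _))// expr2 ler_wpM2l//.
  by rewrite addrK normrZ ger0_norm ?(ltW s0)// ler_piMl// ltW.
by rewrite lerDr normsq_ge0.
Unshelve. all: by end_near. Qed.

(** Interior sphere condition. With D the scalar product of x - xs and eta, Taylor gives rho x <=
    gam D + M |x - xs|^2, and x lies in the ball exactly when |x - xs|^2 < - 2 tau D; hence rho x <
    0 once 2 M tau <= gam. *)
Lemma interior_ball O xs : open O -> smooth_boundary O -> boundary O xs ->
  exists eta tau, [/\ outer_normal O xs eta, 0 < tau
    & forall x, normsq (x - (xs - tau *: eta)) < tau ^+ 2 -> O x].
Proof.
move=> oO sO bxs; have [U [rho [Uxs ld]]] := sO xs bxs.
have [oU srho gne0 Orho] := ld.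
pose gam := Num.sqrt (normsq (grad rho xs)).
have gam0 : 0 < gam.
  by rewrite sqrtr_gt0 lt_neqAle normsq_ge0 andbT eq_sym normsq_eq0 gne0.
pose eta := gam^-1 *: grad rho xs.
have eta1 : normsq eta = 1.
  by rewrite normsqZ exprVn sqr_sqrtr ?normsq_ge0// mulVf// normsq_eq0 gne0.
have nU : \forall y \near xs, U y by apply: open_nbhs_nbhs.
have drho : \forall y \near xs, differentiable rho y.
  by apply: filterS nU => y; exact: (srho [::]).
have dprho i : differentiable (partial i rho) xs by exact: (srho [:: i]).
have rho_le0 : rho xs <= 0.
  have [clxs _] := bxs; rewrite leNgt; apply/negP => rxs.
  have crho : rho y @[y --> xs] --> rho xs.
    by apply: differentiable_continuous; exact: (srho [::]).
  have [y [Oy [Uy ry]]] := clxs _ (filterI nU (cvgr_gt _ crho _ rxs)).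
  by have := (Orho y Uy).1 Oy; rewrite ltNge ltW.
have [M M0 hM] := second_order_bound drho dprho.
have [e e0 he] := near_cball (filterI nU hM).
(* The second bound keeps the ball, of diameter 2 tau, within the range e of the Taylor estimate. *)
pose tau := Num.min (gam / (2 * M)) (e / 2).
have tau0 : 0 < tau by rewrite lt_min !divr_gt0// mulr_gt0.
have tauM : tau * (2 * M) <= gam.
  by rewrite -ler_pdivlMr ?mulr_gt0// /tau ge_min lexx.
have taue : tau <= e / 2 by rewrite /tau ge_min lexx orbT.
exists eta, tau; split => //; first by exists U, rho.
move=> x xt.
have eta_norm : `|eta| <= 1.
  by rewrite -(ler_pXn2r (n := 2))// ?nnegrE// expr1n (le_trans (norm_le_normsq _))// eta1.
have xe : `|x - xs| <= e.
  rewrite (_ : x - xs = (x - (xs - tau *: eta)) - tau *: eta); last first.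
    by apply/rowP => i; rewrite !mxE; ring.
  rewrite (le_trans (ler_normB _ _))// (_ : e = e / 2 + e / 2); last by field.
  apply: lerD.
    rewrite (le_trans _ taue)// -(ler_pXn2r (n := 2))// ?nnegrE ?(ltW tau0)//.
    by rewrite (le_trans (norm_le_normsq _))// ltW.
  by rewrite normrZ gtr0_norm// (le_trans _ taue)// ler_piMr// ltW.
have [Ux rx] := he x xe.
apply/(Orho x Ux); apply: (le_lt_trans rx).
pose D := \sum_i (x - xs) ord0 i * eta ord0 i.
have DE : \sum_i (x - xs) ord0 i * partial i rho xs = gam * D.
  rewrite /D mulr_sumr; apply: eq_bigr => i _.
  by rewrite /eta !mxE; field; rewrite gt_eqF.
have nE : normsq (x - (xs - tau *: eta)) = normsq (x - xs) + 2 * tau * D + tau ^+ 2.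
  have -> : tau ^+ 2 = tau ^+ 2 * normsq eta by rewrite eta1 mulr1.
  rewrite /D /normsq !mulr_sumr -!big_split/=.
  by apply: eq_bigr => i _; rewrite !mxE; ring.
rewrite DE; have := normsq_ge0 (x - xs).
move: xt; rewrite nE; set q := normsq _ => xt q0.
have D0 : 2 * tau * D < - q by lra.
have : 2 * tau * (rho xs + gam * D + M * q) < 0.
  have h1 : 2 * tau * rho xs <= 0 by rewrite mulr_ge0_le0// mulr_ge0// ltW.
  have h2 : gam * (2 * tau * D) < gam * - q by rewrite ltr_pM2l.
  have h3 : tau * (2 * M) * q <= gam * q by rewrite ler_wpM2r.
  by lra.
by rewrite pmulr_rlt0// mulr_gt0.
Qed.

(** The Hopf lemma in the interior ball gives z (xs - s eta) >= (eps / tau) s for s in [0, tau],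
    against a vanishing normal derivative. *)
Lemma boundary_minimum O B C z xs : open O -> smooth_boundary O ->
  supersolution O B C z -> 0 <= B -> 0 <= C ->
  {within closure O, continuous z} -> (forall x, closure O x -> 0 <= z x) ->
  (forall x, O x -> 0 < z x) -> boundary O xs -> z xs = 0 ->
  ~ (forall eta, outer_normal O xs eta -> normal_derivative z xs eta 0).
Proof.
move=> oO sO ssz B0 C0 cz z0 zpos bxs zxs neu.
have [eta [tau [oeta tau0 ball_O]]] := interior_ball oO sO bxs.
pose y := xs - tau *: eta.
have zball x : normsq (x - y) < tau ^+ 2 -> O x /\ 0 < z x.
  by move=> /ball_O Ox; split=> //; exact: zpos.
have [U [rho [Uxs ld etaE]]] := oeta.
have eta1 : normsq eta = 1.
  have [_ _ gne0 _] := ld.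
  rewrite etaE normsqZ exprVn sqr_sqrtr ?normsq_ge0// mulVf//.
  by rewrite normsq_eq0 gne0.
have xsy : normsq (xs - y) = tau ^+ 2.
  by rewrite /y opprB addrC subrK normsqZ eta1 mulr1.
have [eps eps0 zeps] := hopf oO ssz B0 C0 (exprn_gt0 2 tau0) cz z0 zball xsy.
have e0 : 0 < eps / tau by rewrite divr_gt0.
have := neu eta oeta; rewrite /normal_derivative => /cvgr0Pnorm_lt/(_ _ e0)[t /= t0 ht].
pose s := Num.min tau t / 2.
have s0 : 0 < s by rewrite divr_gt0// lt_min tau0.
have [s1 st] : s <= tau /\ s < t.
  by rewrite /s; case: (leP tau t) => H1; split; lra.
have := ht s; rewrite /= sub0r normrN gtr0_norm// => /(_ st s0).
rewrite zxs sub0r mulrN normrN normrM normfV (gtr0_norm s0) ltr_pdivrMl// ltNge => /negP; apply.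
rewrite (le_trans _ (ler_norm _))//.
have := zeps (s / tau); rewrite divr_ge0 ?(ltW s0) ?(ltW tau0)// ler_pdivrMr// mul1r.
move=> /(_ s1); rewrite (_ : xs + (s / tau) *: (y - xs) = xs - s *: eta); last first.
  by rewrite /y [xs - _ - xs]addrAC subrr sub0r scalerN scalerA divfK ?gt_eqF.
by apply: le_trans; rewrite le_eqVlt; apply/orP; left; apply/eqP; field; rewrite gt_eqF.
Qed.

End interior_ball.

(** * Comparison *)

Section comparison.
Context (R : realType) (d : nat).
Implicit Types (O : set 'rV[R]_d) (f g r u v z H : 'rV[R]_d -> R) (x y a : 'rV[R]_d).

(** The equation holds almost everywhere only, but it identifies the weak Laplacian with (r -
    lambda) v, which is continuous at x and can be evaluated there. *)
Lemma eigenfunction_touching O r lambda v psi G L x :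
  open O -> O x -> {for x, continuous r} -> neumann_eigenfunction O r lambda v ->
  C2_at x psi G L -> (\forall y \near x, v y - psi y <= v x - psi x) ->
  (r x - lambda) * v x <= \sum_i L i x.
Proof.
move=> oO Ox cr [sob [dv _ _] [h [hw hae]] _ _] [cpsi dpsi cL] vmax.
have [Lv _] := sob 1 (lexx _).
apply: (@laplacian_at_max _ _ O v (fun y => (r y - lambda) * v y) psi h G L x) => //.
- by apply/Lfun1_integrable; exact: Lv.
- by move=> i; apply/Lfun1_integrable; exact: (hw i).1.
- by move=> i; exact: (hw i).2.
- by apply: filterS hae => y hy Oy; have := hy Oy; lra.
- by move=> y Oy; exact/differentiable_continuous/dv.
- have cv : v y @[y --> x] --> v x by exact/differentiable_continuous/dv.
  exact: (cvgM (cvgB cr (cvg_cst lambda)) cv).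
Qed.

Lemma smooth_on_derive O f x i : smooth_on O f -> O x ->
  is_derive x (delta_mx ord0 i) f (partial i f x).
Proof. by move=> sf Ox; apply/derivableP/diff_derivable; exact: (sf [::]). Qed.

Lemma smooth_on_partial O f i : smooth_on O f -> smooth_on O (partial i f).
Proof.
move=> sf s x Ox; have := sf (rcons s i) x Ox.
by rewrite /partials -cats1 foldr_cat.
Qed.

Lemma C2_smooth O f x : open O -> smooth_on O f -> O x ->
  C2_at x f (fun i => partial i f) (fun i => partial i (partial i f)).
Proof.
move=> oO sf Ox; have nO : \forall y \near x, O y by apply: open_nbhs_nbhs.
split.
- by apply: filterS nO => y Oy; apply: differentiable_continuous; exact: (sf [::]).
- apply: filterS nO => y Oy i; split; first exact: smooth_on_derive sf Oy.
  exact: smooth_on_derive (smooth_on_partial i sf) Oy.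
- apply: continuous_sum_for => i; apply: differentiable_continuous.
  exact: (sf [:: i; i]).
Qed.

Lemma C2D x H1 G1 L1 H2 G2 L2 : C2_at x H1 G1 L1 -> C2_at x H2 G2 L2 ->
  C2_at x (fun y => H1 y + H2 y) (fun i y => G1 i y + G2 i y)
    (fun i y => L1 i y + L2 i y).
Proof.
move=> [c1 d1 l1] [c2 d2 l2]; split.
- by apply: filterS2 c1 c2 => y c1 c2; exact: (cvgD c1 c2).
- apply: filterS2 d1 d2 => y d1 d2 i.
  have [a1 b1] := d1 i; have [a2 b2] := d2 i.
  by split; [exact: (is_deriveD a1 a2)|exact: (is_deriveD b1 b2)].
- rewrite (_ : (fun _ => _) = (fun y => \sum_i L1 i y + \sum_i L2 i y)).
    exact: (cvgD l1 l2).
  by apply/funext => y; rewrite big_split.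
Qed.

Lemma C2Z x H G L (k : R) : C2_at x H G L ->
  C2_at x (fun y => k * H y) (fun i y => k * G i y) (fun i y => k * L i y).
Proof.
move=> [c1 d1 l1]; split.
- by apply: filterS c1 => y c1; exact: (cvgM (cvg_cst k) c1).
- apply: filterS d1 => y d1 i; have [a1 b1] := d1 i.
  by split; [exact: (is_deriveZ k a1)|exact: (is_deriveZ k b1)].
- rewrite (_ : (fun _ => _) = (fun y => k * \sum_i L i y)).
    exact: (cvgM (cvg_cst k) l1).
  by apply/funext => y; rewrite mulr_sumr.
Qed.

Section touching.
Variables (O : set 'rV[R]_d) (r : 'rV[R]_d -> R) (lambda : R) (v1 : 'rV[R]_d -> R).
Variables (c E th : R) (g u v : 'rV[R]_d -> R).
Hypothesis oO : open O.
Hypothesis cr : forall x, O x -> {for x, continuous r}.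
Hypothesis ev1 : neumann_eigenfunction O r lambda v1.
Hypothesis E0 : 0 < E.
Hypothesis th0 : 0 < th.
Hypothesis th1 : th < 1.
Hypothesis level : forall x, O x ->
  E * lambda * v1 x + 2^-1 * E ^+ 2 * normsq (grad v1 x) <= - c.
Hypothesis g_ge : forall x, O x -> - c <= g x.
Hypothesis su : smooth_on O u.
Hypothesis sv : smooth_on O v.
Hypothesis u_sub : forall x, O x ->
  - laplacian u x + 2^-1 * normsq (grad u x) + r x * u x <= g x.
Hypothesis v_super : forall x, O x ->
  g x <= - laplacian v x + 2^-1 * normsq (grad v x) + r x * v x.

Definition gap x := v x - th * u x - (1 - th) * (E * v1 x).

Lemma differentiable_v1 x : O x -> differentiable v1 x.
Proof. by case: ev1 => _ [dv _ _] _ _ _; exact: dv. Qed.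

Lemma differentiable_gap x : O x -> differentiable gap x.
Proof.
move=> Ox; rewrite (_ : gap = v - th *: u - ((1 - th) * E) *: v1).
  apply: differentiableB; last exact/differentiableZ/differentiable_v1.
  by apply: differentiableB; [exact: (sv [::])|apply: differentiableZ; exact: (su [::])].
by apply/funext => y; rewrite /gap mulrA.
Qed.

(* Convexity of the Hamiltonian: the quadratic gain comes from
   th |p|^2 + (1 - th) |q|^2 = |th p + (1 - th) q|^2 + th (1 - th) |p - q|^2. *)
Lemma touching_below x H G L : O x -> C2_at x H G L ->
  (\forall y \near x, gap x - H x <= gap y - H y) ->
  (forall i, G i x =
    partial i v x - th * partial i u x - (1 - th) * (E * partial i v1 x)) /\
  \sum_i L i x +
    2^-1 * (th * (1 - th)) * \sum_i (partial i u x - E * partial i v1 x) ^+ 2 <=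
  \sum_i G i x * partial i v x + r x * gap x.
Proof.
(* The final addition of inequalities, with Laplacians and square norms abstracted; the multiples th
   and 1 - th of g add up to g. *)
have arith LH Lv Lu Nv Nu Nw Gv S (ux vx wx gx rx : R) :
    (1 - th) * E * ((rx - lambda) * wx) <= Lv + - th * Lu + -1 * LH ->
    gx <= - Lv + 2^-1 * Nv + rx * vx ->
    th * (- Lu + 2^-1 * Nu + rx * ux) <= th * gx ->
    (1 - th) * (E * lambda * wx + 2^-1 * E ^+ 2 * Nw) <= (1 - th) * gx ->
    2^-1 * Nv - th * (2^-1 * Nu) - (1 - th) * (2^-1 * E ^+ 2 * Nw) +
      2^-1 * (th * (1 - th)) * S <= Gv ->
    LH + 2^-1 * (th * (1 - th)) * S <= Gv + rx * (vx - th * ux - (1 - th) * (E * wx)).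
  by lra.
move=> Ox C2H locmin.
have nO : \forall y \near x, O y by apply: open_nbhs_nbhs.
have GE i : G i x =
    partial i v x - th * partial i u x - (1 - th) * (E * partial i v1 x).
  have [_ dH _] := C2H.
  pose D y := partial i v y - th * partial i u y - (1 - th) * (E * partial i v1 y) - G i y.
  have : D x = 0.
    apply: (@first_derivative_min _ _ (fun y => gap y - H y) D x (delta_mx ord0 i)) => //.
    apply: filterS2 nO dH => y Oy /(_ i)[dHy _].
    have dv := smooth_on_derive i sv Oy.
    have du := smooth_on_derive i su Oy.
    have dv1 : is_derive y (delta_mx ord0 i) v1 (partial i v1 y).
      exact/derivableP/diff_derivable/differentiable_v1.
    exact: (is_deriveB (is_deriveB (is_deriveB dv (is_deriveZ th du))
      (is_deriveZ (1 - th) (is_deriveZ E dv1))) dHy).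
  by rewrite /D => /eqP; rewrite subr_eq0 => /eqP.
split=> //.
have a0 : 0 < (1 - th) * E by rewrite mulr_gt0// subr_gt0.
(* Solving the definition of [gap] for v1: since H touches the gap from below, (v - th u - H) / ((1
   - th) E) touches v1 from above. *)
have C2psi := C2Z ((1 - th) * E)^-1 (C2D (C2D (C2_smooth oO sv Ox)
  (C2Z (- th) (C2_smooth oO su Ox))) (C2Z (-1) C2H)).
have := @eigenfunction_touching O r lambda v1 _ _ _ x oO Ox (cr Ox) ev1 C2psi.
have vmax : \forall y \near x,
    v1 y - ((1 - th) * E)^-1 * (v y + - th * u y + -1 * H y) <=
    v1 x - ((1 - th) * E)^-1 * (v x + - th * u x + -1 * H x).
  apply: filterS locmin => y hy.
  have E1 w : v1 w - ((1 - th) * E)^-1 * (v w + - th * u w + -1 * H w) =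
      - (((1 - th) * E)^-1 * (gap w - H w)).
    by rewrite /gap; field; rewrite !gt_eqF ?subr_gt0.
  by rewrite !E1 lerN2 ler_pM2l// invr_gt0.
move/(_ vmax); rewrite -mulr_sumr ler_pdivlMl// !big_split/= -!mulr_sumr => hlap.
have hv := v_super Ox; have hu := u_sub Ox; have hl := level Ox; have hg := g_ge Ox.
rewrite /laplacian in hv hu.
(* Since G is the gradient of the gap at x, the two sides differ by exactly |G|^2 / 2. *)
have conv : 2^-1 * normsq (grad v x) - th * (2^-1 * normsq (grad u x)) -
    (1 - th) * (2^-1 * E ^+ 2 * normsq (grad v1 x)) +
    2^-1 * (th * (1 - th)) * \sum_i (partial i u x - E * partial i v1 x) ^+ 2 <=
    \sum_i G i x * partial i v x.
  rewrite /normsq !mulr_sumr -!sumrB -big_split/=; apply: ler_sum => i _.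
  rewrite GE !mxE -subr_ge0.
  set p := partial i v x; set q := partial i u x; set w := partial i v1 x.
  rewrite (_ : _ - _ = 2^-1 * (p - th * q - (1 - th) * (E * w)) ^+ 2); last by field.
  by rewrite mulr_ge0// sqr_ge0.
have hu' : th * (- (\sum_i partial i (partial i u) x) + 2^-1 * normsq (grad u x) +
    r x * u x) <= th * g x by rewrite ler_pM2l.
have hl' : (1 - th) * (E * lambda * v1 x + 2^-1 * E ^+ 2 * normsq (grad v1 x)) <=
    (1 - th) * g x.
  by rewrite ler_pM2l ?subr_gt0// (le_trans hl hg).
exact: (arith _ _ _ _ _ _ _ _ _ _ _ _ _ hlap hv hu' hl' conv).
Qed.

End touching.
End comparison.

Section closure.
Context (R : realType) (d : nat).
Implicit Types (O : set 'rV[R]_d) (f g r u v : 'rV[R]_d -> R) (x y : 'rV[R]_d).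

Lemma compact_closure_bounded O : bounded_set O -> compact (closure O).
Proof.
move=> /ex_strict_bound_gt0[M M0 OM].
apply: (@subclosed_compact _ _ [set x : 'rV[R]_d | `|x - 0| <= M]).
- exact: closed_closure.
- exact: compact_cball.
have clS : closed [set x : 'rV[R]_d | `|x - 0| <= M].
  by apply: compact_closed; [exact: norm_hausdorff|exact: compact_cball].
rewrite [X in _ `<=` X](iffLR (closure_id _) clS).
by apply: closure_subset => x Ox /=; rewrite subr0; exact/ltW/OM.
Qed.

Lemma compact_continuous_bounded (K : set 'rV[R]_d) f : compact K -> {within K, continuous f} ->
  exists2 M, 0 <= M & forall x, K x -> `|f x| <= M.
Proof.
move=> cK cf.
have /ex_strict_bound_gt0[M M0 fM] : bounded_set (f @` K).
  exact/compact_bounded/continuous_compact.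
exists M; first exact: ltW.
by move=> x Kx; apply/ltW/fM; exists x.
Qed.

Lemma normal_derivative_comb f1 f2 f3 (a b : R) x eta :
  normal_derivative f1 x eta 0 -> normal_derivative f2 x eta 0 ->
  normal_derivative f3 x eta 0 ->
  normal_derivative (fun y => f1 y - a * f2 y - b * f3 y) x eta 0.
Proof.
move=> n1 n2 n3; rewrite /normal_derivative.
have := cvgB (cvgB n1 (cvgM (cvg_cst a) n2)) (cvgM (cvg_cst b) n3).
rewrite !mulr0 !subr0 => h; rewrite (_ : (fun t : R => _) = (fun t : R =>
  t^-1 * (f1 x - f1 (x - t *: eta)) - a * (t^-1 * (f2 x - f2 (x - t *: eta))) -
  b * (t^-1 * (f3 x - f3 (x - t *: eta))))); first exact: h.
by apply/funext => t; ring.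
Qed.

End closure.

Unset Implicit Arguments.

Theorem lemma4 (R : realType) (d : nat) (hd : (0 < d)%N)
    (O : set 'rV[R]_d) (hO : smooth_bounded_domain O)
    (r : 'rV[R]_d -> R) (hr : {within closure O, continuous r})
    (lambda1 : R) (hlambda1 : first_eigenvalue O r lambda1)
    (v1 : 'rV[R]_d -> R) (hv1 : first_eigenfunction O r lambda1 v1)
    (lambda1_lt0 : lambda1 < 0)
    (r_pos : exists2 x0, O x0 & 0 < r x0)
    (c : R) (c_gt0 : 0 < c) (hc : (- c)%:E = inf_sup_level O lambda1 v1)
    (epsbar : R) (epsbar_gt0 : 0 < epsbar)
    (hepsbar : sup_level O lambda1 v1 epsbar = inf_sup_level O lambda1 v1)
    (g : 'rV[R]_d -> R) (hg : {within O, continuous g})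
    (g_ge : forall x, O x -> - c <= g x)
    (u v : 'rV[R]_d -> R)
    (hu : smooth_closure O u) (hv : smooth_closure O v)
    (u_ge : forall x, closure O x -> epsbar * v1 x <= u x)
    (v_gt : forall x, closure O x -> epsbar * v1 x < v x)
    (u_sub : forall x, O x ->
       - laplacian u x + 2^-1 * normsq (grad u x) + r x * u x <= g x)
    (v_super : forall x, O x ->
       g x <= - laplacian v x + 2^-1 * normsq (grad v x) + r x * v x)
    (u_neumann : neumann O u) (v_neumann : neumann O v) :
  forall x, closure O x -> u x <= v x.
Proof.
(* By the eigenvalue equation the left-hand side is -lap w + |grad w|^2 / 2 + r w for w = epsbar v1:
   this is the subsolution property of w. *)
have level x : O x ->
    epsbar * lambda1 * v1 x + 2^-1 * epsbar ^+ 2 * normsq (grad v1 x) <= - c.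
  by move=> Ox; rewrite -lee_fin hc -hepsbar; apply: ereal_sup_ubound; exists x.
have [ev1 _ _] := hv1.
have [neO oO cO bO sO] := hO.
have [su cu _] := hu; have [sv cv pv] := hv.
have [_ [dv1 cv1 _] _ v1_neumann _] := ev1.
have cK := compact_closure_bounded bO.
have Ocl x : O x -> closure O x by exact: subset_closure.
have crO x : O x -> {for x, continuous r}.
  move=> Ox; have := continuous_subspaceW (@subset_closure _ O) hr.
  by rewrite continuous_open_subspace// => /(_ x); apply; rewrite inE.
pose w x := epsbar * v1 x.
have cw : {within closure O, continuous w}.
  by move=> x; exact: (cvgM (cvg_cst epsbar) (cv1 x)).
have vw0 x : closure O x -> 0 < v x - w x by move=> /v_gt; rewrite subr_gt0.
pose q x := (u x - w x) / (v x - w x).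
have cq : {within closure O, continuous q}.
  rewrite continuous_subspace_in => x xO.
  apply: cvgM; first exact: (cvgB (cu x) (cw x)).
  apply: cvgV; last exact: (cvgB (cv x) (cw x)).
  by rewrite gt_eqF// vw0//; rewrite inE in xO.
have [p0 Op0] := neO.
have [xs /set_mem clxs qmax] := EVT_max_rV (ex_intro _ p0 (Ocl p0 Op0)) cK cq.
have {}qmax x : closure O x -> q x <= q xs by move=> clx; apply: qmax; rewrite inE.
have uq x : closure O x -> u x - w x <= q xs * (v x - w x).
  by move=> clx; rewrite -ler_pdivrMr ?vw0//; exact: qmax.
have [q1|q1] := leP (q xs) 1.
  move=> x clx; have := uq x clx; have := vw0 x clx.
  have : q xs * (v x - w x) <= v x - w x by rewrite ler_piMl// ltW// vw0.
  by lra.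
exfalso.
pose th := (q xs)^-1.
have q0 : 0 < q xs by rewrite (lt_trans _ q1).
have th0 : 0 < th by rewrite invr_gt0.
have th1 : th < 1 by rewrite invf_lt1.
pose z := gap v1 epsbar th u v.
have zE x : z x = (v x - w x) - th * (u x - w x) by rewrite /z /gap /w; ring.
have z0 x : closure O x -> 0 <= z x.
  by move=> clx; rewrite zE subr_ge0 /th ler_pdivrMl// uq.
have zxs : z xs = 0.
  rewrite zE /th /q invf_div divfK ?subrr//.
  apply/eqP => uw; move: q0; rewrite /q uw mul0r ltxx//.
have cz : {within closure O, continuous z}.
  by move=> x; exact: (cvgB (cvgB (cv x) (cvgM (cvg_cst th) (cu x)))
    (cvgM (cvg_cst (1 - th)) (cw x))).
have touch := touching_below oO crO ev1 epsbar_gt0 th0 th1 level g_ge su sv u_sub v_super.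
have [C C0 rC] := compact_continuous_bounded cK hr.
(* The drift grad v is bounded because its components extend continuously to the compact closure. *)
have /choice[Bi hBi] : forall i, exists B, 0 <= B /\ forall x, O x -> `|partial i v x| <= B.
  move=> i; have [h ch hE] := pv [:: i].
  have [B B0 hB] := compact_continuous_bounded cK ch.
  by exists B; split=> // x Ox; rewrite [partial i v x](hE x Ox); exact/hB/Ocl.
have Bi0 i : 0 <= Bi i by have [] := hBi i.
pose B := \sum_i Bi i.
have B0 : 0 <= B by exact: sumr_ge0.
have ssz : supersolution O B C z.
  move=> x H G L Ox C2H locmin.
  have [_ main] := touch x H G L Ox C2H locmin.
  have th01 : 0 <= th * (1 - th) by rewrite mulr_ge0// ?subr_ge0 ltW.
  (* Here the convexity gain is merely dropped; its exact value serves once z is known to vanish. *)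
  have gain : 0 <= 2^-1 * (th * (1 - th)) *
      \sum_i (partial i u x - epsbar * partial i v1 x) ^+ 2.
    apply: mulr_ge0; first by rewrite mulr_ge0// invr_ge0.
    by apply: sumr_ge0 => i _; exact: sqr_ge0.
  have hG : \sum_i G i x * partial i v x <= B * \sum_i `|G i x|.
    rewrite mulr_sumr; apply: ler_sum => i _.
    rewrite (le_trans (ler_norm _))// normrM mulrC ler_wpM2r//.
    have [_ hi] := hBi i; rewrite (le_trans (hi x Ox))// /B (bigD1 i)//= lerDl.
    by rewrite sumr_ge0.
  have hz : r x * z x <= C * `|z x|.
    by rewrite (le_trans (ler_norm _))// normrM ler_wpM2r// rC//; exact: Ocl.
  by move: main; rewrite -/z; lra.
have dz x : O x -> differentiable z x by exact: (differentiable_gap epsbar th ev1 su sv).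
have [[a Oa za]|no_zero] := pselect (exists2 a, O a & z a = 0); last first.
  have zpos x : O x -> 0 < z x.
    move=> Ox; rewrite lt_neqAle z0 ?andbT; last exact: Ocl.
    by apply/eqP => /esym zx; apply: no_zero; exists x.
  have bxs : boundary O xs.
    split=> //; rewrite (interior_id _).1// => Oxs.
    by apply: no_zero; exists xs.
  apply: (boundary_minimum oO sO ssz B0 C0 cz z0 zpos bxs zxs) => eta oeta.
  rewrite (_ : z = fun y => v y - th * u y - ((1 - th) * epsbar) * v1 y).
    by apply: normal_derivative_comb; [exact: v_neumann|exact: u_neumann|exact: v1_neumann].
  by apply/funext => y; rewrite /z /gap mulrA.
have zO := strong_maximum oO cO ssz B0 C0 cz dz z0 (ex_intro2 _ _ a Oa za).
have C2_0 x : C2_at x (fun _ : 'rV[R]_d => 0 : R) (fun _ _ => 0) (fun _ _ => 0).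
  split.
  - by apply: (@nearW _ (nbhs x) _ (nbhs_filter x)) => y; exact: (@cst_continuous _ _ (0 : R)).
  - by apply: (@nearW _ (nbhs x) _ (nbhs_filter x)) => y i; split; exact: is_derive_cst.
  - rewrite (_ : (fun _ => _) = cst 0); first exact: cst_continuous.
    by apply/funext => y; rewrite big1.
(* As z = 0 in O, the zero function touches z from below at every point. The touching inequality
   then reduces to gain <= 0, so grad u = grad w, and grad z = 0 gives grad v = grad u. *)
have grad_eq x i : O x -> partial i v x = partial i u x.
  move=> Ox; have nO : \forall y \near x, O y by apply: open_nbhs_nbhs.
  have [|GE main] := touch x _ _ _ Ox (C2_0 x).
    by apply: filterS nO => y Oy; rewrite !subr0 -/z !zO.
  move: main; rewrite -/z zO// mulr0 addr0 [X in X + _]big1// add0r.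
  rewrite [X in _ <= X]big1; last by move=> j _; rewrite mul0r.
  have th01 : 0 < 2^-1 * (th * (1 - th)) by rewrite !mulr_gt0 ?invr_gt0 ?subr_gt0.
  rewrite pmulr_rle0// => le0.
  have /eqP : \sum_i (partial i u x - epsbar * partial i v1 x) ^+ 2 = 0.
    by apply/eqP; rewrite eq_le le0 sumr_ge0// => j _; exact: sqr_ge0.
  rewrite psumr_eq0; last by move=> j _; exact: sqr_ge0.
  move=> /allP/(_ i (mem_index_enum i))/=; rewrite sqrf_eq0 subr_eq0 => /eqP uE.
  by have := GE i; rewrite -uE; lra.
have lap_eq x : O x -> laplacian v x = laplacian u x.
  move=> Ox; have nO : \forall y \near x, O y by apply: open_nbhs_nbhs.
  apply: eq_bigr => i _; rewrite /partial; apply: near_eq_derive.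
  by apply: filterS nO => y Oy; exact: grad_eq.
have [x0 Ox0 rx0] := r_pos.
have gradE : grad v x0 = grad u x0 by apply/rowP => i; rewrite !mxE grad_eq.
have := v_super x0 Ox0; have := u_sub x0 Ox0.
rewrite lap_eq// gradE => h1 h2.
have h3 : r x0 * u x0 <= r x0 * v x0 by lra.
rewrite ler_pM2l// in h3.
(* From v - w = th (u - w) with v > w and th < 1 follows u > v at x0, against [h3]. *)
have := zO x0 Ox0; rewrite zE => /eqP; rewrite subr_eq0 => /eqP h4.
have h5 := vw0 x0 (Ocl x0 Ox0).
have h6 : 0 < u x0 - w x0 by rewrite -(pmulr_rgt0 _ th0) -h4.
have : th * (u x0 - w x0) < u x0 - w x0 by rewrite gtr_pMl.
by lra.
Qed.
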